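(* Let $Q$ be a non-degenerate quadratic form on $\mathbb{F}_{q^t}^r$ corresponding to the polar space $\mathcal{Q}$, and let $L_\alpha:\mathbb{F}_{q^t}\to\mathbb{F}_q$, $x\mapsto Tr(\alpha x)$, with $\alpha\in\mathbb{F}_{q^t}^*$. Suppose $L_\alpha Q$ is non-degenerate and let $\mathcal{Q}'$ denote the polar space defined by $L_\alpha Q$. Then the following holds: (i) if $\mathcal{Q}$ is of hyperbolic type, then so is $\mathcal{Q}'$; (ii) if $\mathcal{Q}$ is of elliptic type, then so is $\mathcal{Q}'$; (iii) if $\mathcal{Q}$ is of parabolic type, choose $\gamma\in\mathbb{F}_{q^t}^*$ a square if $\mathrm{sign}(\mathcal{Q})=1$ and a non-square if $\mathrm{sign}(\mathcal{Q})=-1$; then $q$ is odd and - $\mathcal{Q}'$ is of parabolic type if $t$ is odd; - if $t$ is even, then $\mathcal{Q}'$ is of hyperbolic type if (a) $q^{t/2}\equiv 1 \pmod 4$ and $\alpha\gamma$ is a non-square in $\mathbb{F}_{q^t}$, or (b) $q^{t/2}\equiv 3\pmod 4$ and $\alpha\gamma$ is a square in $\mathbb{F}_{q^t}$; - $\mathcal{Q}'$ is of elliptic type in the remaining cases.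
   Context: Here $q$ is a prime power and $r,t$ are positive integers. $Tr=Tr_{\mathbb{F}_{q^t}/\mathbb{F}_q}:x\mapsto x+x^q+\dots+x^{q^{t-1}}$ is the trace map. The space $\mathbb{F}_{q^t}^r$ is regarded as an $rt$-dimensional vector space over $\mathbb{F}_q$, identified with $\mathbb{F}_q^{rt}$, so $L_\alpha Q=L_\alpha\circ Q$ is a quadratic form on $\mathbb{F}_q^{rt}$. The polar space $\mathcal{Q}$ lies in the projective space $\mathrm{PG}(r-1,q^t)$ of $\mathbb{F}_{q^t}^r$, and $\mathcal{Q}'$ lies in the projective space $\mathrm{PG}(rt-1,q)$ of $\mathbb{F}_q^{rt}$. For a quadratic form $Q$ over a field $\mathbb{F}$, put $\beta_Q(x,y)=Q(x+y)-Q(x)-Q(y)$. A quadratic form is called non-degenerate if its associated bilinear form $\beta_Q$ is non-degenerate; in particular, when $q$ is even and $r$ is odd, $L_\alpha Q$ is always degenerate. The orthogonal polar space in $\mathrm{PG}(n,q)$ of a quadratic form $Q$ in $n+1$ variables consists of the points $\mathbb{F}_qv$ with $Q(v)=0$ and the subspaces contained in this point set. Up to a change of coordinates and a nonzero scalar factor, the form is: if $n$ is even, $X_0^2+X_1X_2+\dots+X_{n-1}X_n$ (parabolic type); if $n$ is odd, either $X_0X_1+\dots+X_{n-1}X_n$ (hyperbolic type) or $f(X_0,X_1)+X_2X_3+\dots+X_{n-1}X_n$ with $f$ an irreducible homogeneous quadratic form over the field (elliptic type). The same definitions are used over $\mathbb{F}_{q^t}$. A hyperbolic line is a line containing two points $\mathbb{F}x,\mathbb{F}y$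 with $Q(x)=Q(y)=0$ and $\beta_Q(x,y)=1$. A quadratic form of parabolic type in $2n+1$ variables is the orthogonal sum (with respect to $\beta_Q$) of $n$ hyperbolic lines and a point $\mathbb{F}x_0$ with $Q(x_0)\neq 0$; the sign of the corresponding parabolic quadric $\mathcal{Q}$ is $\mathrm{sign}(\mathcal{Q})=+1$ if $Q(x_0)$ is a square in the field and $-1$ otherwise. *)

(* Defs.v *)
From HB Require Import structures.
From mathcomp Require Import all_boot all_order all_algebra all_fingroup all_field.
From mathcomp Require Import mpoly.

Set Implicit Arguments.
Unset Strict Implicit.
Unset Printing Implicit Defensive.

Import GRing.Theory.
Local Open Scope ring_scope.

Definition polar_form (K : fieldType) (N : nat) (Q : 'rV[K]_N -> K)
    (x y : 'rV[K]_N) : K :=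
  Q (x + y) - Q x - Q y.

(* Linearity in the second argument follows, as polar_form Q is symmetric. *)
Definition quadratic_form (K : fieldType) (N : nat) (Q : 'rV[K]_N -> K) : Prop :=
  (forall (a : K) (x : 'rV[K]_N), Q (a *: x) = a ^+ 2 * Q x) /\
  (forall (a : K) (x y z : 'rV[K]_N),
     polar_form Q (a *: x + y) z = a * polar_form Q x z + polar_form Q y z).

Definition nondegenerate_quadratic (K : fieldType) (N : nat) (Q : 'rV[K]_N -> K) : Prop :=
  forall x : 'rV[K]_N, (forall y : 'rV[K]_N, polar_form Q x y = 0) -> x = 0.

Definition is_square (K : fieldType) (a : K) : Prop := exists b : K, a = b ^+ 2.

(* The coordinate X_k of x, indexed by a natural number; the default value 0
   (for N <= k) is never reached in the normal forms below. *)
Definition Xc (K : fieldType) (N : nat) (x : 'rV[K]_N) (k : nat) : K :=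
  oapp (fun i : 'I_N => x 0 i) 0 (insub k).

Definition irreducible_elt (R : idomainType) (p : R) : Prop :=
  [/\ p != 0, p \isn't a GRing.unit &
      forall a b : R, p = a * b -> a \is a GRing.unit \/ b \is a GRing.unit].

Definition hyperbolic_normal_form (K : fieldType) (m N : nat) (x : 'rV[K]_N) : K :=
  \sum_(i < m) Xc x i.*2 * Xc x i.*2.+1.

Definition parabolic_normal_form (K : fieldType) (m N : nat) (x : 'rV[K]_N) : K :=
  Xc x 0 ^+ 2 + \sum_(i < m) Xc x i.*2.+1 * Xc x i.*2.+2.

Definition elliptic_normal_form (K : fieldType) (f : {mpoly K[2]}) (m N : nat)
    (x : 'rV[K]_N) : K :=
  f.@[fun i : 'I_2 => Xc x i] + \sum_(i < m) Xc x i.*2.+2 * Xc x i.*2.+3.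

Definition equivalent_up_to_scalar (K : fieldType) (N : nat)
    (Q Q0 : 'rV[K]_N -> K) : Prop :=
  exists (c : K) (A : 'M[K]_N),
    [/\ c != 0, A \in unitmx & forall x : 'rV[K]_N, Q (x *m A) = c * Q0 x].

(* The type of the polar space of Q. Here N is the number of variables, so the
   ambient projective space is PG(N - 1, K). *)
Definition hyperbolic_type (K : fieldType) (N : nat) (Q : 'rV[K]_N -> K) : Prop :=
  exists m : nat,
    N = m.*2 /\ equivalent_up_to_scalar Q (@hyperbolic_normal_form K m N).

Definition parabolic_type (K : fieldType) (N : nat) (Q : 'rV[K]_N -> K) : Prop :=
  exists m : nat,
    N = m.*2.+1 /\ equivalent_up_to_scalar Q (@parabolic_normal_form K m N).

Definition elliptic_type (K : fieldType) (N : nat) (Q : 'rV[K]_N -> K) : Prop :=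
  exists (m : nat) (f : {mpoly K[2]}),
    [/\ N = m.*2.+2, f \is 2.-homog, irreducible_elt f &
        equivalent_up_to_scalar Q (@elliptic_normal_form K f m N)].

Definition hyperbolic_line (K : fieldType) (N : nat) (Q : 'rV[K]_N -> K)
    (l : {vspace 'rV[K]_N}) : Prop :=
  \dim l = 2%N /\
  exists x y : 'rV[K]_N,
    [/\ x \in l, y \in l, Q x = 0, Q y = 0 & polar_form Q x y = 1].

Definition orthogonal_spaces (K : fieldType) (N : nat) (Q : 'rV[K]_N -> K)
    (U W : {vspace 'rV[K]_N}) : Prop :=
  forall u w : 'rV[K]_N, u \in U -> w \in W -> polar_form Q u w = 0.

Definition parabolic_decomposition (K : fieldType) (N : nat) (Q : 'rV[K]_N -> K)
    (n : nat) (l : 'I_n -> {vspace 'rV[K]_N}) (x0 : 'rV[K]_N) : Prop :=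
  [/\ forall i : 'I_n, hyperbolic_line Q (l i),
      Q x0 != 0,
      forall i j : 'I_n, i != j -> orthogonal_spaces Q (l i) (l j),
      forall i : 'I_n, orthogonal_spaces Q (l i) <[x0]>%VS &
      directv (\sum_(i < n) l i + <[x0]>)%VS /\
      (\sum_(i < n) l i + <[x0]>)%VS = fullv].

(* "The parabolic quadric of Q has sign s." *)
Definition has_sign (K : fieldType) (N : nat) (Q : 'rV[K]_N -> K) (s : int) : Prop :=
  exists (n : nat) (l : 'I_n -> {vspace 'rV[K]_N}) (x0 : 'rV[K]_N),
    [/\ N = n.*2.+1, parabolic_decomposition Q l x0 &
        (is_square (Q x0) /\ s = 1) \/ (~ is_square (Q x0) /\ s = -1)].

Definition trace_sum (F : finFieldType) (L : fieldExtType F) (x : L) : L :=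
  \sum_(i < \dim {:L}) x ^+ (#|F| ^ i).

(* trace_sum x lies in the image of F in L (see traceE below), and trace x is
   the corresponding element of F. *)
Definition trace (F : finFieldType) (L : fieldExtType F) (x : L) : F :=
  odflt 0 [pick a : F | a%:A == trace_sum x].

Lemma traceE (F : finFieldType) (L : fieldExtType F) (x : L) :
  (trace x)%:A = trace_sum x.
Proof.
rewrite /trace; case: pickP => [a /eqP // | no_a].
have : trace_sum x \in 1%AS.
  have [p [n p_pr Fpn]] : {p & {n | prime p & #|F| = (p ^ n)%N}}.
    have [p p_pr Fp] := finPcharP F.
    by exists p, (logn p #|F|) => //; rewrite -(card_pprimeChar Fp).
  have chL : p \in [pchar L] by rewrite pchar_lalg (card_finPcharP Fpn).
  have qnat : [pchar L].-nat #|F|.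
    by rewrite Fpn pnatX (pnatE _ p_pr) chL.
  have sumX (k : nat) :
      (\sum_(i < k) x ^+ (#|F| ^ i)) ^+ #|F| = \sum_(i < k) x ^+ (#|F| ^ i.+1).
    elim: k => [|k IHk].
      by rewrite !big_ord0 expr0n eqn0Ngt (ltnW (finNzRing_gt1 F)).
    by rewrite !big_ord_recr /= exprDn_pchar // IHk -exprM -expnSr.
  rewrite Fermat's_little_theorem dimv1 expn1 /trace_sum sumX.
  have /eqP xq : x ^+ (#|F| ^ \dim {:L}) == x.
    by rewrite -Fermat's_little_theorem memvf.
  have : (0 < \dim {:L})%N by rewrite adim_gt0.
  case: (\dim {:L}) xq => // d xq _.
  rewrite big_ord_recr [X in _ == X]big_ord_recl /= xq expn0 expr1 addrC.
  by apply/eqP.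
by case/vlineP=> a /eqP; rewrite eq_sym no_a.
Qed.

Definition Lmap (F : finFieldType) (L : fieldExtType F) (alpha x : L) : F :=
  trace (alpha * x).

(* An F-linear identification of F^N with L^r, where F acts on L^r through its
   embedding a |-> a%:A in L. *)
Definition identification (F : finFieldType) (L : fieldExtType F) (N r : nat)
    (phi : 'rV[F]_N -> 'rV[L]_r) : Prop :=
  bijective phi /\
  forall (a : F) (u v : 'rV[F]_N), phi (a *: u + v) = a%:A *: phi u + phi v.

(* The form L_alpha Q = L_alpha \o Q, in the coordinates given by phi. *)
Definition LQ (F : finFieldType) (L : fieldExtType F) (N r : nat)
    (phi : 'rV[F]_N -> 'rV[L]_r) (alpha : L) (Q : 'rV[L]_r -> L)
    (v : 'rV[F]_N) : F :=
  Lmap alpha (Q (phi v)).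

(* Main.v *)
Require Import Defs.
From HB Require Import structures.
From mathcomp Require Import all_boot all_order all_algebra all_fingroup all_field.
From mathcomp Require Import mpoly ring zify.

Set Implicit Arguments.
Unset Strict Implicit.
Unset Printing Implicit Defensive.

Import GRing.Theory.
Local Open Scope ring_scope.

(** Over a finite field the type of a nondegenerate quadratic form is visible
    in its number of zeros, so it suffices to count the zeros of L_alpha Q.

    Every nondegenerate form over a finite field with k elements is the
    orthogonal sum of hyperbolic planes and of an anisotropic form in at most
    two variables ([witt_decomposition]); hence it is parabolic in odd dimension,
    and hyperbolic or elliptic in even dimension 2m.  Adding a hyperbolic plane
    multiplies k Z(a) - k^N by k, where Z(a) is the number of vectors of value
    a ([fiber_witt_sum]).  So k Z(0) = k^(2m) + eps (k - 1) k^m, with eps = 1 for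
    hyperbolic and eps = -1 for elliptic forms, and eps decides the type
    ([zeros_even_type]).

    The key step is [zeros_transfer].  Let a map U from a finite set with P^2
    elements into an additive group E take all nonzero values equally often, and
    let its number of zeros be given by the formula above, with E in the role of
    the field and P in the role of k^m.  Composing U with an additive map l
    from E onto F gives a map whose number of zeros satisfies the same formula
    over F, with the same P and the same eps.

    For Q hyperbolic or elliptic over K, take E = K, U = Q and l = L_alpha.  The
    nonzero values of Q are equidistributed ([fiber_uniform]): in characteristic 2
    because all scalars are squares, otherwise because Q - a z^2 is a
    nondegenerate form in an odd number of variables, whose number of zeros does
    not depend on a.  So the type is preserved.

    A parabolic form forces odd characteristic ([parabolic_char]), since in
    characteristic 2 the vector of the first coordinate lies in the radical.  If t
    is odd then L_alpha Q lives in odd dimension and is parabolic.  If t is even,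
    let E be the subfield of order e = q^(t/2) of K and T(y) = y + y^e the trace
    from K to E.  The trace to F of y is the trace of T(y) / 2, so L_alpha Q is an
    additive functional of U = T(alpha Q), which takes values in E.  Nonzero
    elements of E are squares in K, so scaling of vectors shows that U is
    equidistributed.  Its zeros are the vectors with alpha Q in the kernel of T;
    the nonzero elements b of this kernel satisfy b^(e-1) = -1, so by Euler's
    criterion all of them are squares in K if e = 3 mod 4, and none is if
    e = 1 mod 4.  As Q is c X_0^2 plus hyperbolic planes, with c in the square
    class of gamma, the number of vectors with alpha Q = b depends only on whether
    b / (alpha c) is a square, and the formula holds for U with eps = 1 exactly
    when e = 3 mod 4 is equivalent to alpha c being a square
    ([rel_trace_zeros], [parabolic_descent]). *)

(** * Polar forms and isometries *)

Section PolarForm.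
Variables (K : fieldType) (N : nat) (Q : 'rV[K]_N -> K).
Hypothesis quadQ : quadratic_form Q.

Lemma quadraticZ a x : Q (a *: x) = a ^+ 2 * Q x.
Proof. by case: quadQ. Qed.

Lemma quadraticD x y : Q (x + y) = Q x + Q y + polar_form Q x y.
Proof. by rewrite /polar_form; ring. Qed.

Lemma quadratic0 : Q 0 = 0.
Proof. by rewrite -[0 in LHS](scale0r (0 : 'rV_N)) quadraticZ expr0n mul0r. Qed.

Lemma polarC x y : polar_form Q x y = polar_form Q y x.
Proof. by rewrite /polar_form [y + x]addrC; ring. Qed.

Lemma polar_linearl a x y z :
  polar_form Q (a *: x + y) z = a * polar_form Q x z + polar_form Q y z.
Proof. by case: quadQ. Qed.

Lemma polarDl x y z : polar_form Q (x + y) z = polar_form Q x z + polar_form Q y z.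
Proof. by rewrite -[x]scale1r polar_linearl mul1r scale1r. Qed.

Lemma polar0l z : polar_form Q 0 z = 0.
Proof. by rewrite /polar_form add0r quadratic0; ring. Qed.

Lemma polarZl a x z : polar_form Q (a *: x) z = a * polar_form Q x z.
Proof. by rewrite -[a *: x]addr0 polar_linearl polar0l addr0. Qed.

Lemma polarZr a x z : polar_form Q x (a *: z) = a * polar_form Q x z.
Proof. by rewrite polarC polarZl polarC. Qed.

Lemma polarDr x y z : polar_form Q x (y + z) = polar_form Q x y + polar_form Q x z.
Proof. by rewrite ![polar_form Q x _]polarC polarDl. Qed.

Lemma polar0r z : polar_form Q z 0 = 0.
Proof. by rewrite polarC polar0l. Qed.

Lemma polarxx x : polar_form Q x x = 2%:R * Q x.
Proof.
by rewrite /polar_form -mulr2n -scaler_nat quadraticZ; ring.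
Qed.

Lemma polar_sumr (I : Type) (r : seq I) (P : pred I) (F : I -> 'rV[K]_N) x :
  polar_form Q x (\sum_(i <- r | P i) F i) = \sum_(i <- r | P i) polar_form Q x (F i).
Proof.
apply: (big_morph (polar_form Q x)) => [y z|]; [exact: polarDr | exact: polar0r].
Qed.

End PolarForm.

Lemma rV_linear_mx (K : fieldType) n p (g : 'rV[K]_n -> 'rV[K]_p) :
    (forall a x y, g (a *: x + y) = a *: g x + g y) ->
  exists M : 'M[K]_(n, p), forall x, g x = x *m M.
Proof.
move=> lin_g.
pose gL := HB.pack_for {linear 'rV[K]_n -> 'rV[K]_p} g
  (GRing.isLinear.Build K 'rV[K]_n 'rV[K]_p *:%R g lin_g).
by exists (lin1_mx gL) => x; rewrite mul_rV_lin1.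
Qed.

Lemma polar_pair_mx (K : fieldType) N (Q : 'rV[K]_N -> K) (e f : 'rV[K]_N) :
    quadratic_form Q ->
  exists M : 'M[K]_(N, 2), forall x,
    (x *m M) 0 0 = polar_form Q x e /\ (x *m M) 0 1 = polar_form Q x f.
Proof.
move=> qQ.
pose g (x : 'rV[K]_N) : 'rV[K]_2 :=
  \row_j (if j == 0 then polar_form Q x e else polar_form Q x f).
have [|M gM] := @rV_linear_mx K N 2 g.
  move=> a x y; apply/rowP => j; rewrite !mxE.
  by case: ifP => _; rewrite polar_linearl.
by exists M => x; rewrite -gM !mxE.
Qed.

Definition isometric (K : fieldType) N (Q Q0 : 'rV[K]_N -> K) : Prop :=
  exists2 A : 'M[K]_N, A \in unitmx & forall x, Q (x *m A) = Q0 x.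

Lemma isometric_refl (K : fieldType) N (Q Q0 : 'rV[K]_N -> K) :
  Q =1 Q0 -> isometric Q Q0.
Proof. by move=> QE; exists 1%:M; rewrite ?unitmx1 // => x; rewrite mulmx1. Qed.

Lemma isometric_trans (K : fieldType) N (Q1 Q2 Q3 : 'rV[K]_N -> K) :
  isometric Q1 Q2 -> isometric Q2 Q3 -> isometric Q1 Q3.
Proof.
move=> [A uA QA] [B uB QB]; exists (B *m A); first by rewrite unitmx_mul uB.
by move=> x; rewrite mulmxA QA QB.
Qed.

Lemma quadratic_mulmx (K : fieldType) N M (Q : 'rV[K]_N -> K) (A : 'M[K]_(M, N)) :
  quadratic_form Q -> quadratic_form (fun x => Q (x *m A)).
Proof.
move=> qQ; split=> [a x|a x y z]; first by rewrite -scalemxAl quadraticZ.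
have E u v : polar_form (fun x => Q (x *m A)) u v = polar_form Q (u *m A) (v *m A).
  by rewrite /polar_form mulmxDl.
by rewrite !E mulmxDl -scalemxAl polar_linearl.
Qed.

(** The orthogonal sum of Q and a hyperbolic plane.  The plane occupies the last
    two coordinates because in all normal forms the anisotropic part comes
    first. *)
Definition plane_sum (K : fieldType) N (Q : 'rV[K]_N -> K) (x : 'rV[K]_(N + 2)) : K :=
  Q (lsubmx x) + rsubmx x 0 0 * rsubmx x 0 1.

Lemma unitmx_rV_inj (K : fieldType) n (A : 'M[K]_n) :
  (forall x : 'rV_n, x *m A = 0 -> x = 0) -> A \in unitmx.
Proof.
move=> injA; rewrite -row_free_unit -kermx_eq0; apply/eqP/row_matrixP => i.
by rewrite row0; apply: injA; apply/sub_kermxP; exact: row_sub.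
Qed.

Lemma ord2E (i : 'I_2) : i = if i == 0 then 0 else 1.
Proof. by case: i => [[|[|i]] Hi]; apply: val_inj. Qed.

(** * Splitting off a hyperbolic plane *)

(** Any y not orthogonal to the isotropic vector e can be scaled to pair to 1
    with e; subtracting Q(y) e then kills its value without changing the
    pairing, since e is orthogonal to itself. *)
Lemma hyperbolic_pair (K : fieldType) N (Q : 'rV[K]_N -> K) e :
    quadratic_form Q -> nondegenerate_quadratic Q -> e != 0 -> Q e = 0 ->
  exists2 f, Q f = 0 & polar_form Q e f = 1.
Proof.
move=> qQ ndQ e0 Qe.
have [y Bey] : exists y, polar_form Q e y != 0.
  have [/'forall_eqP H|] := boolP [forall i, polar_form Q e (delta_mx 0 i) == 0].
    case/eqP: e0; apply: ndQ => y; rewrite [y]row_sum_delta polar_sumr // big1 // => i _.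
    by rewrite polarZr // H mulr0.
  by rewrite negb_forall => /existsP[i Hi]; exists (delta_mx 0 i).
pose y1 := (polar_form Q e y)^-1 *: y.
have By1 : polar_form Q e y1 = 1 by rewrite polarZr // mulVf.
clearbody y1.
exists (y1 + (- Q y1) *: e).
  by rewrite quadraticD quadraticZ // polarZr // Qe polarC By1; ring.
by rewrite polarDr // polarZr // polarxx // Qe By1; ring.
Qed.

(** The orthogonal complement of a hyperbolic pair is the kernel of an N + 2 by 2
    matrix of rank 2; a basis of it, completed by the pair, is a basis of the
    whole space because the pair meets this kernel trivially. *)
Lemma split_plane (K : fieldType) N (Q : 'rV[K]_(N + 2) -> K) e :
    quadratic_form Q -> nondegenerate_quadratic Q -> e != 0 -> Q e = 0 ->
  exists Q1 : 'rV[K]_N -> K, [/\ quadratic_form Q1, nondegenerate_quadratic Q1 &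
     isometric Q (plane_sum Q1)].
Proof.
move=> qQ ndQ e0 Qe.
have [f Qf Bef] := hyperbolic_pair qQ ndQ e0 Qe.
have [M MP] := polar_pair_mx e f qQ.
pose P : 'M[K]_(2, N + 2) := \matrix_(i < 2) (if i == 0 then e else f).
have mulP (z : 'rV_2) : z *m P = z 0 0 *: e + z 0 1 *: f.
  rewrite mulmx_sum_row big_ord_recl big_ord1 !rowK /=.
  by congr (_ *: _ + _ *: _); congr (z _ _); apply: val_inj.
have Bee : polar_form Q e e = 0 by rewrite polarxx // Qe mulr0.
have Bff : polar_form Q f f = 0 by rewrite polarxx // Qf mulr0.
have PM (z : 'rV_2) : (z *m P *m M) 0 0 = z 0 1 /\ (z *m P *m M) 0 1 = z 0 0.
  have [-> ->] := MP (z *m P); rewrite mulP !polarDl // !polarZl // Bee Bff.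
  by rewrite Bef [polar_form Q f e]polarC Bef !mulr0 !mulr1 addr0 add0r.
have PM_inj (z : 'rV_2) : z *m P *m M = 0 -> z = 0.
  move=> zPM; have [z1 z0] := PM z; rewrite zPM !mxE in z0 z1.
  by apply/rowP => j; rewrite mxE [j]ord2E; case: ifP.
have rkM : \rank M = 2%N.
  apply/eqP; rewrite eqn_leq rank_leq_col /=.
  have rkPM : \rank (P *m M) = 2%N.
    apply/mxrank_unit/unitmx_rV_inj => z; rewrite mulmxA; exact: PM_inj.
  by have := mxrankM_maxr P M; rewrite rkPM.
have [B freeB BM] : exists2 B : 'M[K]_(N, N + 2), row_free B & B *m M = 0.
  have rkK : \rank (kermx M) = N by rewrite mxrank_ker rkM addnK.
  move: (row_base (kermx M)) (row_base_free (kermx M)) (eq_row_base (kermx M)).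
  rewrite rkK => B freeB eqB; exists B => //.
  by apply/sub_kermxP; rewrite eqB.
have BP y w : polar_form Q (y *m B) (w *m P) = 0.
  have [H0 H1] := MP (y *m B); rewrite -mulmxA BM mulmx0 !mxE in H0 H1.
  by rewrite mulP polarDr // !polarZr // -H0 -H1 !mulr0 addr0.
pose A : 'M[K]_(N + 2) := col_mx B P.
have mulA x : x *m A = lsubmx x *m B + rsubmx x *m P.
  by rewrite -[in LHS](hsubmxK x) mul_row_col.
have uA : A \in unitmx.
  apply: unitmx_rV_inj => x; rewrite mulA => xA.
  have x2 : rsubmx x = 0.
    apply: PM_inj; have := congr1 (mulmx^~ M) xA.
    by rewrite mulmxDl mul0mx -mulmxA BM mulmx0 add0r.
  move: xA; rewrite x2 mul0mx addr0 => x1.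
  have {}x1 : lsubmx x = 0 by apply: (row_free_inj freeB); rewrite x1 mul0mx.
  by rewrite -(hsubmxK x) x1 x2 row_mx0.
exists (fun y => Q (y *m B)); split; first exact: quadratic_mulmx.
- move=> y yB; suff: y *m B = 0 by move=> H; apply: (row_free_inj freeB); rewrite H mul0mx.
  apply: ndQ => z; rewrite -[z](mulmxKV uA) mulA polarDr // BP addr0.
  by have := yB (lsubmx (z *m invmx A)); rewrite /polar_form mulmxDl.
- exists A => // x; rewrite mulA quadraticD BP addr0 /plane_sum mulP; congr (_ + _).
  by rewrite quadraticD polarZr // polarZl // !quadraticZ // Qe Qf Bef; ring.
Qed.

(** * Squares and isotropic vectors over finite fields *)

Lemma finField_odd (K : finFieldType) : odd #|K| = (2%:R != 0 :> K).
Proof.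
have [p p_pr chK] := finPcharP K.
have Kp := card_pprimeChar chK.
have n_gt0 : (0 < logn p #|K|)%N.
  by rewrite lt0n; apply/eqP => n0; have := finNzRing_gt1 K; rewrite Kp n0.
rewrite Kp oddX eqn0Ngt n_gt0 /= -(dvdn_pcharf chK).
case: (even_prime p_pr) => [->//|odd_p]; rewrite odd_p gtnNdvd //.
by rewrite ltn_neqAle prime_gt1 // andbT; apply/eqP => p2; rewrite -p2 in odd_p.
Qed.

(** A nonzero square has at most two roots and 0 has one, so more than half of
    the elements are squares. *)
Lemma card_sqr_image (K : finFieldType) :
  (#|K| < 2 * #|[set x ^+ 2 | x : K]|)%N.
Proof.
set S := [set x ^+ 2 | x : K].
have S0 : 0 \in S by apply/imsetP; exists 0; rewrite ?expr0n.
have fib (y : K) : (#|[set x : K | x ^+ 2 == y]| <= (y != 0%R).+1)%N.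
  have [->|y0] := eqVneq y 0.
    rewrite -(cards1 (0 : K)); apply/subset_leq_card/subsetP => x.
    by rewrite !inE expf_eq0.
  have [->|[x]] := set_0Vmem [set x : K | x ^+ 2 == y]; first by rewrite cards0.
  rewrite inE => /eqP xy; rewrite -xy.
  have -> : [set x0 | x0 ^+ 2 == x ^+ 2] = [set x; - x].
    by apply/setP => z; rewrite !inE eqf_sqr.
  by rewrite cards2; case: eqP.
have -> : #|K| = (\sum_(y in S) #|[set x : K | x ^+ 2 == y]|)%N.
  rewrite -sum1_card (partition_big (fun x : K => x ^+ 2) (mem S)) /=; last first.
    by move=> x _; apply: imset_f.
  by apply: eq_bigr => y _; rewrite -sum1_card; apply: eq_bigl => x; rewrite inE.
rewrite (bigD1 0) //=.
rewrite (cardsD1 0 S) S0 mulnDr muln1 addSn ltnS.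
apply: leq_add; first by have := fib 0; rewrite eqxx.
rewrite mulnC -sum_nat_const.
rewrite [X in (_ <= X)%N](eq_bigl (fun i => (i \in S) && (i != 0))).
  by apply: leq_sum => y /andP[_ y0]; have := fib y; rewrite y0.
by move=> y; rewrite !inE andbC.
Qed.

(** Pigeonhole: the values u a^2 and the values w - v b^2 each fill more than half
    of the field, so they meet. *)
Lemma sum_of_two_squares (K : finFieldType) (u v w : K) :
  u != 0 -> v != 0 -> exists a b, u * a ^+ 2 + v * b ^+ 2 = w.
Proof.
move=> u0 v0; set S := [set x ^+ 2 | x : K].
pose A := [set u * x | x in S]; pose B := [set w - v * x | x in S].
have cA : #|A| = #|S| by rewrite card_imset //; apply: mulfI.
have cB : #|B| = #|S|.
  by rewrite card_imset // => x y /addrI/oppr_inj/(mulfI v0).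
have [H|[z]] := set_0Vmem (A :&: B).
  have := cardsUI A B; rewrite H cards0 addn0 cA cB addnn -mul2n => cU.
  by have := card_sqr_image K; rewrite -/S -cU ltnNge max_card.
rewrite inE => /andP[/imsetP[_ /imsetP[a _ ->] ->] /imsetP[_ /imsetP[b _ ->]]].
by move=> H; exists a, b; rewrite H subrK.
Qed.

Lemma even_char_sqrt (K : finFieldType) (y : K) :
  ~~ odd #|K| -> exists x, x ^+ 2 = y.
Proof.
rewrite finField_odd negbK => /eqP K2.
have inj2 : injective (fun x : K => x ^+ 2).
  move=> x z /eqP; rewrite eqf_sqr => /orP[] /eqP // ->.
  by apply/eqP; rewrite eq_sym -subr_eq0 opprK -mulr2n -mulr_natl K2 mul0r.
by exists (invF inj2 y); rewrite (f_invF inj2).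
Qed.

Lemma common_zero (K : fieldType) N (M : 'M[K]_(N, 2)) :
  (2 < N)%N -> exists2 z : 'rV[K]_N, z != 0 & z *m M = 0.
Proof.
move=> N2; have : kermx M != 0.
  rewrite -mxrank_eq0 mxrank_ker subn_eq0 -ltnNge.
  exact: leq_ltn_trans (rank_leq_col M) N2.
case/rowV0Pn=> z /sub_kermxP zM z0; by exists z.
Qed.

(** In odd characteristic take three pairwise orthogonal vectors x, y, z: the
    equation a^2 Q(x) + b^2 Q(y) = - Q(z) is solvable.  In characteristic 2, where
    three such independent vectors need not exist, two orthogonal vectors x, y
    suffice, because - Q(x) / Q(y) is a square. *)
Lemma isotropic_vector (K : finFieldType) N (Q : 'rV[K]_N -> K) :
  quadratic_form Q -> (2 < N)%N -> exists2 x, x != 0 & Q x = 0.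
Proof.
move=> qQ N2.
case: (pickP (fun x => (x != 0) && (Q x == 0))) => [x /andP[x0 /eqP Qx]|anis].
  by exists x.
have {}anis x : x != 0 -> Q x != 0.
  by move=> x0; have := anis x; rewrite x0 /= => /negbT.
have [x x0] : exists x : 'rV[K]_N, x != 0.
  by have [x x0 _] := common_zero (0 : 'M[K]_(N, 2)) N2; exists x.
have [oddK|evenK] := boolP (odd #|K|).
  have K2 : 2%:R != 0 :> K by rewrite -finField_odd.
  have [M MP] := polar_pair_mx x x qQ.
  have [y y0 yM] := common_zero M N2.
  have [yx _] := MP y; rewrite yM mxE in yx.
  have [M' MP'] := polar_pair_mx x y qQ.
  have [z z0 zM] := common_zero M' N2.
  have [zx zy] := MP' z; rewrite zM !mxE in zx zy.
  have [a [b ab]] := sum_of_two_squares (- Q z) (anis x x0) (anis y y0).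
  have wz : polar_form Q (a *: x + b *: y + z) z = 2%:R * Q z.
    rewrite !polarDl // !polarZl // polarxx // -[polar_form Q x z]polarC -zx.
    by rewrite -[polar_form Q y z]polarC -zy; ring.
  exists (a *: x + b *: y + z).
    apply: contraTneq (mulf_neq0 K2 (anis z z0)) => w0; rewrite -wz w0 polar0l //.
    by rewrite eqxx.
  rewrite quadraticD polarDl // !polarZl // -[polar_form Q x z]polarC -zx.
  rewrite -[polar_form Q y z]polarC -zy quadraticD polarZl // polarZr //.
  by rewrite -[polar_form Q x y]polarC -yx !quadraticZ // mulrC [_ * Q y]mulrC ab; ring.
(* Killing a coordinate in which x does not vanish keeps y off the line of x. *)
have [j xj] : exists j, x 0 j != 0 by apply/rV0Pn.
have [M MP] : exists M : 'M[K]_(N, 2), forall y,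
    (y *m M) 0 0 = polar_form Q y x /\ (y *m M) 0 1 = y 0 j.
  have [|M gM] := @rV_linear_mx K N 2
     (fun y => \row_i (if i == 0 then polar_form Q y x else y 0 j)).
    move=> a y z; apply/rowP => i; rewrite !mxE.
    by case: ifP => _; rewrite ?polar_linearl.
  by exists M => y; rewrite -gM !mxE.
have [y y0 yM] := common_zero M N2.
have [yx yj] := MP y; rewrite yM !mxE in yx yj.
have [l ll] := even_char_sqrt (- Q x / Q y) evenK.
exists (x + l *: y).
  by apply: contra_neq xj => /rowP/(_ j); rewrite !mxE -yj mulr0 addr0.
rewrite quadraticD polarZr // -[polar_form Q x y]polarC -yx quadraticZ // ll.
by rewrite divfK ?anis //; ring.
Qed.

(** * Witt decomposition over a finite field *)

Section WittSum.
Variable K : fieldType.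

Definition first_coords N0 N (x : 'rV[K]_N) : 'rV[K]_N0 := \row_(i < N0) Xc x i.

(** The common shape of the three normal forms: a form b in the first N0
    coordinates plus m hyperbolic planes, for N = N0 + 2m. *)
Definition witt_sum N0 N (b : 'rV[K]_N0 -> K) (m : nat) (x : 'rV[K]_N) : K :=
  b (first_coords N0 x) + \sum_(i < m) Xc x (N0 + i.*2) * Xc x (N0 + i.*2).+1.

Lemma Xc_ord N (x : 'rV[K]_N) (i : 'I_N) : Xc x i = x 0 i.
Proof. by rewrite /Xc insubT //= => Hi; congr (x 0 _); apply: val_inj. Qed.

Lemma Xc_lsubmx N M (x : 'rV[K]_(N + M)) k : (k < N)%N -> Xc (lsubmx x) k = Xc x k.
Proof.
move=> kN; rewrite -[k]/(val (Ordinal kN)) Xc_ord mxE.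
by rewrite -Xc_ord.
Qed.

Lemma Xc_rsubmx N M (x : 'rV[K]_(N + M)) (i : 'I_M) : Xc x (N + i) = rsubmx x 0 i.
Proof. by rewrite mxE -Xc_ord. Qed.

Lemma witt_sum0 N (b : 'rV[K]_N -> K) : witt_sum b 0 =1 b.
Proof.
move=> x; rewrite /witt_sum big_ord0 addr0; congr b.
by apply/rowP => i; rewrite mxE Xc_ord.
Qed.

Lemma witt_sumS N0 (b : 'rV[K]_N0 -> K) m N (x : 'rV[K]_(N + 2)) :
  N = (N0 + m.*2)%N -> witt_sum b m.+1 x = plane_sum (@witt_sum N0 N b m) x.
Proof.
move=> NE; rewrite /plane_sum /witt_sum big_ord_recr /= addrA; congr (_ + _ + _).
- congr b; apply/rowP => i; rewrite !mxE Xc_lsubmx //.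
  by rewrite (leq_trans (ltn_ord i)) // NE leq_addr.
- by apply: eq_bigr => i _; rewrite !Xc_lsubmx //; have := ltn_ord i; lia.
- by rewrite -!Xc_rsubmx -NE /= addn0 addn1.
Qed.

End WittSum.

Lemma plane_sum_isometric (K : fieldType) N (Q Q' : 'rV[K]_N -> K) :
  isometric Q Q' -> isometric (plane_sum Q) (plane_sum Q').
Proof.
case=> A uA QA; exists (block_mx A 0 0 1%:M).
  by rewrite unitmxE det_lblock det1 mulr1 -unitmxE.
move=> x; rewrite -{1}(hsubmxK x) mul_row_block !mulmx0 mulmx1 addr0 add0r.
by rewrite /plane_sum row_mxKl row_mxKr QA.
Qed.

(** Hyperbolic planes are split off as long as there is an isotropic vector, which
    [isotropic_vector] provides in dimension at least 3. *)
Lemma witt_decomposition (K : finFieldType) N (Q : 'rV[K]_N -> K) :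
    quadratic_form Q -> nondegenerate_quadratic Q ->
  exists N0 m (b : 'rV[K]_N0 -> K),
    [/\ N = (N0 + m.*2)%N /\ (N0 <= 2)%N, quadratic_form b,
        forall x, b x = 0 -> x = 0 & isometric Q (witt_sum b m)].
Proof.
elim/ltn_ind: N Q => N IH Q qQ ndQ.
case: (pickP (fun x => (x != 0) && (Q x == 0))) => [e /andP[e0 /eqP Qe]|anis].
  case: N => [|[|N]] in Q IH qQ ndQ e e0 Qe *.
  - by case/eqP: e0; apply/rowP => -[].
  (* A nondegenerate form in one variable has no isotropic vector: it would be
     orthogonal to its multiples, that is, to everything. *)
  - have [f Qf] := hyperbolic_pair qQ ndQ e0 Qe.
    have e00 : e 0 0 != 0.
      by apply: contra_neq e0 => e00; apply/rowP => i; rewrite ord1 mxE.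
    have -> : f = (f 0 0 / e 0 0) *: e by apply/rowP => i; rewrite ord1 mxE divfK.
    rewrite polarZr // polarxx // Qe !mulr0 => /esym/eqP; by rewrite oner_eq0.
  - move: Q IH qQ ndQ e e0 Qe; rewrite -addn2 => Q IH qQ ndQ e e0 Qe.
    have [Q1 [qQ1 ndQ1 QQ1]] := split_plane qQ ndQ e0 Qe.
    have [|N0 [m [b [[NE N02] qb ab Q1b]]]] := IH N _ Q1 qQ1 ndQ1; first by lia.
    exists N0, m.+1, b; split=> //; first by split=> //; lia.
    apply: isometric_trans QQ1 _; apply: isometric_trans (plane_sum_isometric Q1b) _.
    by apply: isometric_refl => x; rewrite -witt_sumS.
exists N, 0%N, Q; split=> //.
- split; first by rewrite addn0.
  rewrite leqNgt; apply/negP => /(isotropic_vector qQ)[x x0 Qx].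
  by have := anis x; rewrite x0 Qx eqxx.
- move=> x Qx; apply/eqP; have := anis x.
  by rewrite Qx eqxx andbT => /negbFE.
- by apply: isometric_refl => x; rewrite witt_sum0.
Qed.

(** * Irreducible binary forms *)

Section BinaryForms.
Variable K : fieldType.
Implicit Types p f g : {mpoly K[2]}.

Lemma mpoly2_ind (P : {mpoly K[2]} -> Prop) p :
    P 0 -> (forall g h, P g -> P h -> P (g + h)) ->
    (forall c (m : 'X_{1..2}), m \in msupp p ->
       P (c%:MP * ('X_0 ^+ m 0 * 'X_1 ^+ m 1))) ->
  P p.
Proof.
move=> P0 PD Pm; rewrite [p]mpolyE big_seq_cond; apply: big_ind => // m.
rewrite andbT => /(Pm p@_m); rewrite mul_mpolyC (mpolyXE_id _ m) big_ord_recl big_ord1.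
by have -> : lift ord0 ord0 = 1 :> 'I_2 by apply: val_inj.
Qed.

Definition binary_mpoly (a b c : K) : {mpoly K[2]} :=
  a%:MP * 'X_0 ^+ 2 + b%:MP * ('X_0 * 'X_1) + c%:MP * 'X_1 ^+ 2.

Lemma meval_binary a b c (v : 'I_2 -> K) :
  (binary_mpoly a b c).@[v] = a * v 0 ^+ 2 + b * (v 0 * v 1) + c * v 1 ^+ 2.
Proof. by rewrite /binary_mpoly !(mevalD, mevalM, mevalC, expr2, mevalXU). Qed.

Lemma binary_homog a b c : binary_mpoly a b c \is 2.-homog.
Proof.
have hX (i : 'I_2) : 'X_i \is [in K[2], 1.-homog] by rewrite dhomogX /= mdeg1.
by rewrite /binary_mpoly !mul_mpolyC !dhomogD // dhomogZ // ?expr2 -[2%N]/(1 + 1)%N dhomogM.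
Qed.

Lemma mdeg2 (m : 'X_{1..2}) : mdeg m = (m 0%R + m 1%R)%N.
Proof.
rewrite mdegE big_ord_recl big_ord1; by congr (_ + m _)%N; apply: val_inj.
Qed.

Lemma homog2_binary f : f \is 2.-homog -> exists a b c, f = binary_mpoly a b c.
Proof.
move=> /dhomogP hom_f.
apply: (mpoly2_ind (P := fun f => exists a b c, f = binary_mpoly a b c)).
- by exists 0, 0, 0; rewrite /binary_mpoly mpolyC0; ring.
- move=> _ _ [a [b [c ->]]] [a' [b' [c' ->]]].
  by exists (a + a'), (b + b'), (c + c'); rewrite /binary_mpoly !mpolyCD; ring.
move=> c m /hom_f; rewrite /= mdeg2.
case: (m 0) (m 1) => [|[|[|i]]] [|[|[|j]]] //= _.
- by exists 0, 0, c; rewrite /binary_mpoly mpolyC0; ring.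
- by exists 0, c, 0; rewrite /binary_mpoly mpolyC0; ring.
- by exists c, 0, 0; rewrite /binary_mpoly mpolyC0; ring.
Qed.

Lemma msize_le2 g : (msize g <= 2)%N -> exists a b c, g = a%:MP + b%:MP * 'X_0 + c%:MP * 'X_1.
Proof.
move=> g2; apply: (mpoly2_ind (P := fun g => exists a b c, g = _)).
- by exists 0, 0, 0; rewrite mpolyC0; ring.
- move=> _ _ [a [b [c ->]]] [a' [b' [c' ->]]].
  by exists (a + a'), (b + b'), (c + c'); rewrite !mpolyCD; ring.
move=> c m /msize_mdeg_lt; rewrite mdeg2 => /leq_trans/(_ g2).
case: (m 0) (m 1) => [|[|i]] [|[|j]] //= _.
- by exists c, 0, 0; rewrite mpolyC0; ring.
- by exists 0, 0, c; rewrite mpolyC0; ring.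
- by exists 0, c, 0; rewrite mpolyC0; ring.
Qed.

Lemma unit_meval p (v : 'I_2 -> K) : p \is a GRing.unit -> p.@[v] != 0.
Proof.
move=> Up; have /(congr1 (meval v)) := mulrV Up.
rewrite mevalM meval1; by apply: contra_eq_neq => ->; rewrite mul0r eq_sym oner_eq0.
Qed.

(** A nontrivial zero of a binary form gives a linear factor; the two linear
    factors are not units because they vanish at the origin. *)
Lemma irreducible_anisotropic a b c (v : 'I_2 -> K) :
  irreducible_elt (binary_mpoly a b c) -> (binary_mpoly a b c).@[v] = 0 -> v =1 (fun=> 0).
Proof.
move=> [_ _ irr]; rewrite meval_binary => fv.
have lin_nonunit (x y : K) : (x%:MP * 'X_0 + y%:MP * 'X_1 : {mpoly K[2]}) \isn't a GRing.unit.
  apply/negP => /(unit_meval (fun=> 0))/eqP; apply.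
  by rewrite !(mevalM, mevalD, mevalC, mevalXU); ring.
suff /andP[/eqP v0 /eqP v1] : (v 0 == 0) && (v 1 == 0).
  by move=> i; rewrite [i]ord2E; case: ifP.
apply/negPn; rewrite negb_and; apply/negP => /orP[v0|v1].
- pose s := v 1 / v 0.
  have aE : a = - (b * s + c * s ^+ 2).
    apply/eqP; rewrite -subr_eq0 opprK; apply/eqP; transitivity (0 / v 0 ^+ 2).
      by rewrite -fv /s; field.
    by rewrite mul0r.
  have fE : binary_mpoly a b c =
      ((- s)%:MP * 'X_0 + 1%:MP * 'X_1) * ((b + c * s)%:MP * 'X_0 + c%:MP * 'X_1).
    by rewrite /binary_mpoly aE !(mpolyCD, mpolyCN, mpolyCM, expr2, mpolyC1); ring.
  by case: (irr _ _ fE); apply/negP.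
- pose s := v 0 / v 1.
  have cE : c = - (a * s ^+ 2 + b * s).
    apply/eqP; rewrite -subr_eq0 opprK; apply/eqP; transitivity (0 / v 1 ^+ 2).
      by rewrite -fv /s; field.
    by rewrite mul0r.
  have fE : binary_mpoly a b c =
      (1%:MP * 'X_0 + (- s)%:MP * 'X_1) * (a%:MP * 'X_0 + (b + a * s)%:MP * 'X_1).
    by rewrite /binary_mpoly cE !(mpolyCD, mpolyCN, mpolyCM, expr2, mpolyC1); ring.
  by case: (irr _ _ fE); apply/negP.
Qed.

(** In a factorization into nonunits both factors have degree 1, and one of them
    has no constant term since the form vanishes at the origin; the zeros of that
    linear form are nontrivial zeros of the product. *)
Lemma anisotropic_irreducible a b c :
    (forall x y, a * x ^+ 2 + b * (x * y) + c * y ^+ 2 = 0 -> x = 0 /\ y = 0) ->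
  irreducible_elt (binary_mpoly a b c).
Proof.
move=> anis; set f := binary_mpoly a b c.
have f0 : f != 0.
  apply/eqP => /(congr1 (meval (fun i => if i == 0 then 1 else 0))).
  rewrite meval_binary meval0 /= => /anis[/eqP]; by rewrite oner_eq0.
have feval0 : f.@[fun=> 0] = 0 by rewrite meval_binary; ring.
have lin_factor g h : f = g * h -> (msize g <= 2)%N -> g.@[fun=> 0] = 0 -> False.
  move=> fgh /msize_le2[k [u [v gE]]].
  rewrite gE !(mevalD, mevalM, mevalC, mevalXU) !mulr0 !addr0 => k0.
  have /anis[v0 /eqP] : a * v ^+ 2 + b * (v * - u) + c * (- u) ^+ 2 = 0.
    rewrite -(meval_binary a b c (fun i => if i == 0 then v else - u)) -/f fgh mevalM gE.
    by rewrite !(mevalD, mevalM, mevalC, mevalXU) /= k0; ring.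
  rewrite oppr_eq0 => /eqP u0; move: f0.
  by rewrite fgh gE k0 u0 v0 !mpolyC0 !mul0r !addr0 mul0r eqxx.
have nonunit_size g : g != 0 -> g \isn't a GRing.unit -> (1 < msize g)%N.
  move=> g0; apply: contraR; rewrite -leqNgt => /msize1_polyC gE.
  have g00 : g@_0 != 0 by apply: contra_neq g0 => g00; rewrite gE g00 mpolyC0.
  apply/unitrP; exists (g@_0)^-1%:MP; rewrite {2 3}gE -!mpolyCM.
  by rewrite mulVf // mulfV // mpolyC1.
split=> //; first by apply/negP => /(unit_meval (fun=> 0)); rewrite feval0 eqxx.
move=> g h fgh.
have [g0 h0] : g != 0 /\ h != 0 by apply/andP; rewrite -negb_or -mulf_eq0 -fgh.
have f3 : (msize f <= 3)%N.
  have := dhomog_uniq f0 (binary_homog a b c) (dhomog_msize (binary_homog a b c)).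
  by rewrite -/f => /esym; case: (msize f) => // n /= ->.
case: (boolP (g \is a GRing.unit)) => [|/(nonunit_size _ g0) sg]; first by left.
case: (boolP (h \is a GRing.unit)) => [|/(nonunit_size _ h0) sh]; first by right.
have [g2 h2] : (msize g <= 2)%N /\ (msize h <= 2)%N.
  by move: f3 sg sh; rewrite fgh msizeM //; move: (msize g) (msize h) => x y; lia.
have /eqP : g.@[fun=> 0] * h.@[fun=> 0] = 0 by rewrite -mevalM -fgh.
rewrite mulf_eq0 => /orP[]/eqP.
  by move/(lin_factor g h fgh g2).
by move/(lin_factor h g (etrans fgh (mulrC _ _)) h2).
Qed.

End BinaryForms.

(** * The three types as Witt decompositions *)

(** A factor c of the anisotropic part becomes a factor of the whole form after
    one coordinate of each hyperbolic pair is multiplied by c. *)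
Lemma witt_sum_scale (K : fieldType) N0 N m (b b0 : 'rV[K]_N0 -> K) (c : K)
    (Q : 'rV[K]_N -> K) :
    c != 0 -> N = (N0 + m.*2)%N -> (forall x, b x = c * b0 x) ->
    isometric Q (witt_sum b m) ->
  equivalent_up_to_scalar Q (witt_sum b0 m).
Proof.
move=> c0 NE bE [A uA QA].
pose e k : K := if (N0 <= k)%N && odd (k - N0) then c else 1.
pose D : 'M[K]_N := diag_mx (\row_(i < N) e i).
have XcD x k : Xc (x *m D) k = Xc x k * e k.
  have [kN|Nk] := ltnP k N.
    by rewrite -[k]/(val (Ordinal kN)) !Xc_ord mul_mx_diag !mxE.
  by rewrite /Xc insubF ?mul0r // ltnNge Nk.
exists c, (D *m A); split=> //.
  rewrite unitmx_mul uA andbT unitmxE det_diag unitfE; apply/prodf_neq0 => i _.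
  by rewrite mxE /e; case: ifP => _ //; apply: oner_neq0.
move=> x; rewrite mulmxA QA /witt_sum bE mulrDr mulr_sumr; congr (_ * b0 _ + _).
  by apply/rowP => i; rewrite !mxE XcD /e leqNgt ltn_ord mulr1.
apply: eq_bigr => i _; rewrite !XcD /e -addnS !leq_addr !addKn /= odd_double /=.
by ring.
Qed.

Section NormalForms.
Variable K : fieldType.

Lemma hyperbolic_witt m N (x : 'rV[K]_N) :
  hyperbolic_normal_form m x = witt_sum (fun _ : 'rV_0 => 0) m x.
Proof. by rewrite /witt_sum add0r. Qed.

Lemma parabolic_witt m N (x : 'rV[K]_N) :
  parabolic_normal_form m x = witt_sum (fun y : 'rV_1 => y 0 0 ^+ 2) m x.
Proof. by rewrite /witt_sum mxE. Qed.

Lemma elliptic_witt f m N (x : 'rV[K]_N) :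
  elliptic_normal_form f m x = witt_sum (fun y : 'rV_2 => f.@[fun i => y 0 i]) m x.
Proof.
by congr (_ + _); apply: meval_eq => i; rewrite mxE.
Qed.

Lemma equivalent_eq N (Q Q0 Q1 : 'rV[K]_N -> K) :
  Q0 =1 Q1 -> equivalent_up_to_scalar Q Q0 -> equivalent_up_to_scalar Q Q1.
Proof. by move=> Q01 [c [A [c0 uA QA]]]; exists c, A; split=> // x; rewrite QA Q01. Qed.

Variables (N m : nat) (Q : 'rV[K]_N -> K).

Lemma witt0_hyperbolic (b : 'rV[K]_0 -> K) :
    quadratic_form b -> N = m.*2 -> isometric Q (witt_sum b m) ->
  hyperbolic_type Q.
Proof.
move=> qb NE Qb; exists m; split=> //.
apply: equivalent_eq (fun x => esym (hyperbolic_witt m x)) _.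
apply: (witt_sum_scale (oner_neq0 K)) Qb => // x.
by rewrite mulr0 -(quadratic0 qb); congr b; apply/rowP => -[].
Qed.

Lemma witt1_parabolic (b : 'rV[K]_1 -> K) :
    quadratic_form b -> (forall x, b x = 0 -> x = 0) ->
    N = m.*2.+1 -> isometric Q (witt_sum b m) ->
  parabolic_type Q.
Proof.
move=> qb ab NE Qb; exists m; split=> //.
apply: equivalent_eq (fun x => esym (parabolic_witt m x)) _.
have b1 : b (const_mx 1) != 0.
  by apply/eqP => /ab/rowP/(_ 0)/eqP; rewrite !mxE oner_eq0.
apply: (witt_sum_scale b1) Qb => // x.
rewrite mulrC -quadraticZ //; congr b; apply/rowP => i.
by rewrite ord1 !mxE mulr1.
Qed.

Lemma witt2_elliptic (b : 'rV[K]_2 -> K) :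
    quadratic_form b -> (forall x, b x = 0 -> x = 0) ->
    N = m.*2.+2 -> isometric Q (witt_sum b m) ->
  elliptic_type Q.
Proof.
move=> qb ab NE Qb.
pose e0 : 'rV[K]_2 := delta_mx 0 0; pose e1 : 'rV[K]_2 := delta_mx 0 1.
have bE x y : b (x *: e0 + y *: e1) =
    b e0 * x ^+ 2 + polar_form b e0 e1 * (x * y) + b e1 * y ^+ 2.
  by rewrite quadraticD polarZl // polarZr // !quadraticZ //; ring.
have rV2 (z : 'rV[K]_2) : z = z 0 0 *: e0 + z 0 1 *: e1.
  by apply/rowP => i; rewrite [i]ord2E !mxE; case: ifP => _; rewrite /= ?mulr1 ?mulr0 ?addr0 ?add0r.
exists m, (binary_mpoly (b e0) (polar_form b e0 e1) (b e1)); split=> //.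
- exact: binary_homog.
- apply: anisotropic_irreducible => x y; rewrite -bE => /ab xy.
  move: (congr1 (fun z : 'rV_2 => z 0 0) xy) (congr1 (fun z : 'rV_2 => z 0 1) xy).
  by rewrite !mxE /= !mulr1 !mulr0 addr0 add0r.
- apply: equivalent_eq (fun x => esym (elliptic_witt _ m x)) _.
  apply: (witt_sum_scale (oner_neq0 K)) Qb => // x.
  by rewrite mul1r meval_binary -bE -rV2.
Qed.

End NormalForms.

Lemma even_dim_type (K : finFieldType) N (Q : 'rV[K]_N -> K) :
    quadratic_form Q -> nondegenerate_quadratic Q -> ~~ odd N ->
  hyperbolic_type Q \/ elliptic_type Q.
Proof.
move=> qQ ndQ evenN.
have [N0 [m [b [[NE N02] qb ab Qb]]]] := witt_decomposition qQ ndQ.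
case: N0 => [|[|[|N0]]] in b NE N02 qb ab Qb *; last by [].
- by left; apply: witt0_hyperbolic Qb.
- by case/negP: evenN; rewrite NE /= odd_double.
- by right; apply: witt2_elliptic Qb.
Qed.

Lemma odd_dim_type (K : finFieldType) N (Q : 'rV[K]_N -> K) :
    quadratic_form Q -> nondegenerate_quadratic Q -> odd N -> parabolic_type Q.
Proof.
move=> qQ ndQ oddN.
have [N0 [m [b [[NE N02] qb ab Qb]]]] := witt_decomposition qQ ndQ.
case: N0 => [|[|[|N0]]] in b NE N02 qb ab Qb *; last by [].
- by exfalso; move: oddN; rewrite NE /= odd_double.
- exact: witt1_parabolic Qb.
- by exfalso; move: oddN; rewrite NE /= negbK odd_double.
Qed.

(** * Counting the vectors with a given value *)

Lemma Posz_expn (a n : nat) : (a ^ n)%N%:Z = a%:Z ^+ n.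
Proof. by rewrite -[LHS]natz natrX natz. Qed.

Definition fiber_card (T : finType) (R : eqType) (g : T -> R) (a : R) : nat :=
  #|[set x | g x == a]|.

Lemma fiber_cardE (T : finType) (R : eqType) (g : T -> R) a :
  fiber_card g a = (\sum_x (g x == a))%N.
Proof.
rewrite /fiber_card -sum1_card big_mkcond /=; apply: eq_bigr => x _.
by rewrite inE; case: eqP.
Qed.

Lemma eq_fiber_card (T : finType) (R : eqType) (g g' : T -> R) a :
  g =1 g' -> fiber_card g a = fiber_card g' a.
Proof. by move=> gg'; rewrite !fiber_cardE; apply: eq_bigr => x _; rewrite gg'. Qed.

Section Count.
Variable K : finFieldType.
Local Notation k := (#|K|%:Z).

Lemma fiber_isometric N (Q Q0 : 'rV[K]_N -> K) a :
  isometric Q Q0 -> fiber_card Q a = fiber_card Q0 a.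
Proof.
case=> A uA QA; rewrite !fiber_cardE (reindex (mulmx^~ A)) /=.
  by apply: eq_bigr => x _; rewrite QA.
by exists (mulmx^~ (invmx A)) => x _; rewrite ?mulmxK ?mulmxKV.
Qed.

Lemma fiber_equivalent N (Q Q0 : 'rV[K]_N -> K) :
    equivalent_up_to_scalar Q Q0 ->
  exists2 c, c != 0 & forall a, fiber_card Q a = fiber_card Q0 (a / c).
Proof.
case=> c [A [c0 uA QA]]; exists c => // a.
rewrite (@fiber_isometric _ Q (fun x => c * Q0 x)); last by exists A.
rewrite !fiber_cardE; apply: eq_bigr => x _; congr (nat_of_bool _).
by rewrite -(inj_eq (mulfI c0) (Q0 x)) mulrCA mulfV // mulr1.
Qed.

Lemma card_mul_eq (c : K) :
  (\sum_(w : K * K) ((w.1 * w.2)%R == c) = #|K|.-1 + (c == 0%R) * #|K|)%N.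
Proof.
rewrite -(pair_bigA _ (fun u v : K => (u * v == c) : nat)) /=.
rewrite (bigD1 0) //= addnC; congr (_ + _)%N.
  rewrite (eq_bigr (fun=> 1%N)) => [|u u0].
    by rewrite sum1_card (cardC1 (0 : K)).
  rewrite (bigD1 (c / u)) //= mulrC divfK // eqxx big1 // => v.
  by move=> vcu; apply/eqP; rewrite eqb0; apply: contra_neqN vcu => /eqP <-; rewrite mulrC mulKf.
rewrite (eq_bigr (fun=> (c == 0%R) : nat)) => [|v _].
  by rewrite sum_nat_const mulnC.
by rewrite mul0r eq_sym.
Qed.

(** The equation u v = c has k - 1 solutions over a field with k elements, and k
    more if c = 0; sum over the values c = a - Q(y). *)
Lemma fiber_plane_sum N (Q : 'rV[K]_N -> K) a :
  fiber_card (plane_sum Q) a = (#|K|.-1 * #|K| ^ N + #|K| * fiber_card Q a)%N.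
Proof.
pose h (w : 'rV[K]_N * (K * K)) : 'rV[K]_(N + 2) :=
  row_mx w.1 (\row_(j < 2) if j == 0 then w.2.1 else w.2.2).
rewrite !fiber_cardE (reindex h) /=; last first.
  exists (fun x => (lsubmx x, (rsubmx x 0 0, rsubmx x 0 1))).
    by move=> [y [u v]] _; rewrite /h row_mxKl row_mxKr !mxE.
  move=> x _; rewrite /h -[RHS]hsubmxK; congr row_mx; apply/rowP => j.
  by rewrite mxE /= {2}[j]ord2E; case: ifP.
rewrite (eq_bigr (fun p => (plane_sum Q (h (p.1, p.2)) == a) : nat)); last by case.
rewrite -(pair_bigA _ (fun y w => (plane_sum Q (h (y, w)) == a) : nat)) /=.
rewrite (eq_bigr (fun y => (#|K|.-1 + (Q y == a) * #|K|)%N)); last first.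
  move=> y _; rewrite -[Q y == a]subr_eq0 -oppr_eq0 opprB -card_mul_eq.
  apply: eq_bigr => w _; rewrite /plane_sum /h row_mxKl row_mxKr !mxE /=.
  by rewrite [in RHS]eq_sym subr_eq [in RHS]eq_sym addrC.
rewrite big_split /= sum_nat_const card_mx mul1n mulnC; congr (_ + _)%N.
by rewrite -big_distrl /= mulnC.
Qed.

(** The deviation k Z(a) - k^N from equidistribution is multiplied by k with each
    hyperbolic plane. *)
Lemma fiber_witt_sum N0 (b : 'rV[K]_N0 -> K) m N a : N = (N0 + m.*2)%N ->
  k * (fiber_card (@witt_sum K N0 N b m) a)%:Z =
    k ^+ N + k ^+ m * (k * (fiber_card b a)%:Z - k ^+ N0).
Proof.
elim: m N => [|m IHm] N.
  rewrite addn0 => ->; rewrite expr0 mul1r addrC subrK; congr (_ * Posz _).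
  exact/eq_fiber_card/witt_sum0.
rewrite doubleS -addn2 addnA => ->; set N1 := (N0 + _)%N.
rewrite (eq_fiber_card _ (fun x => witt_sumS b x (erefl N1))).
rewrite fiber_plane_sum PoszD !PoszM predn_int ?(ltnW (finNzRing_gt1 K)) //.
by rewrite Posz_expn mulrDr IHm // exprD [k ^+ m.+1]exprS; ring.
Qed.

Lemma hyperbolic_zeros N m (Q : 'rV[K]_N -> K) :
    N = m.*2 -> hyperbolic_type Q ->
  k * (fiber_card Q 0)%:Z = k ^+ N + (k - 1) * k ^+ m.
Proof.
move=> NE [m' [NE' /fiber_equivalent[c c0 ->]]].
have {NE'} -> : m' = m by rewrite NE in NE'; apply: double_inj.
rewrite mul0r (eq_fiber_card _ (@hyperbolic_witt K m N)) fiber_witt_sum // expr0.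
have -> : fiber_card (fun _ : 'rV[K]_0 => 0 : K) 0 = 1%N.
  rewrite fiber_cardE (eq_bigr (fun=> 1%N)) => [|x _]; last by rewrite eqxx.
  by rewrite sum1_card card_mx mul1n.
by ring.
Qed.

Lemma elliptic_zeros N m (Q : 'rV[K]_N -> K) :
    N = m.*2 -> elliptic_type Q ->
  k * (fiber_card Q 0)%:Z = k ^+ N - (k - 1) * k ^+ m.
Proof.
move=> NE [m' [f [NE' hom_f irr_f /fiber_equivalent[c c0 ->]]]].
have {NE'} mE : m = m'.+1 by rewrite NE in NE'; apply: double_inj; rewrite NE' doubleS.
rewrite mul0r (eq_fiber_card _ (@elliptic_witt K f m' N)) fiber_witt_sum; last first.
  by rewrite NE mE.
have -> : fiber_card (fun y : 'rV[K]_2 => f.@[fun i => y 0 i]) 0 = 1%N.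
  have [d [e [g fE]]] := homog2_binary hom_f.
  rewrite fiber_cardE (bigD1 0) //= fE big1 => [|x x0].
    by rewrite meval_binary !mxE expr2 !mulr0 !addr0 eqxx.
  apply/eqP; rewrite eqb0; apply: contra_neqN x0 => /eqP; rewrite -fE.
  rewrite fE in irr_f * => /(irreducible_anisotropic irr_f) x0.
  by apply/rowP => i; rewrite mxE x0.
by rewrite mE [k ^+ m'.+1]exprS; ring.
Qed.

End Count.

(** * Equidistribution of the nonzero values *)

Lemma fiber_scale (K : finFieldType) N (Q : 'rV[K]_N -> K) (l a : K) :
  quadratic_form Q -> l != 0 -> fiber_card Q (l ^+ 2 * a) = fiber_card Q a.
Proof.
move=> qQ l0; rewrite !fiber_cardE (reindex (fun x => l *: x)) /=.
  apply: eq_bigr => x _; rewrite quadraticZ // (inj_eq (mulfI _)) //.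
  by rewrite expf_neq0.
by exists (fun x => l^-1 *: x) => x _; rewrite scalerA ?mulVf ?mulfV ?scale1r.
Qed.

Lemma fiber_line0 (K : finFieldType) (c : K) :
  c != 0 -> fiber_card (fun x : 'rV[K]_1 => c * x 0 0 ^+ 2) 0 = 1%N.
Proof.
move=> c0; rewrite fiber_cardE (bigD1 0) //= mxE expr0n mulr0 eqxx big1 // => x.
move=> x0; apply/eqP; rewrite eqb0; apply: contra_neqN x0.
rewrite mulf_eq0 (negbTE c0) expf_eq0 /= => /eqP x0.
by apply/rowP => i; rewrite ord1 mxE.
Qed.

Lemma parabolic_zeros (K : finFieldType) N (Q : 'rV[K]_N -> K) :
  parabolic_type Q -> #|K|%:Z * (fiber_card Q 0)%:Z = #|K|%:Z ^+ N.
Proof.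
move=> [m [NE /fiber_equivalent[c c0 ->]]].
rewrite mul0r (eq_fiber_card _ (@parabolic_witt K m N)) fiber_witt_sum //.
rewrite -(eq_fiber_card _ (fun x : 'rV[K]_1 => mul1r (x 0 0 ^+ 2))).
by rewrite fiber_line0 ?oner_neq0 //; ring.
Qed.

(** The extra variable z turns the vectors of value a, up to squares, into zeros:
    this reduces counting values of Q to counting zeros of a form. *)
Definition minus_line (K : fieldType) N (Q : 'rV[K]_N -> K) (a : K) (x : 'rV[K]_(N + 1)) : K :=
  Q (lsubmx x) - a * rsubmx x 0 0 ^+ 2.

Lemma polar_minus_line (K : fieldType) N (Q : 'rV[K]_N -> K) a u v :
  polar_form (minus_line Q a) u v =
    polar_form Q (lsubmx u) (lsubmx v) - a * 2%:R * (rsubmx u 0 0 * rsubmx v 0 0).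
Proof. by rewrite /polar_form /minus_line !linearD /= !mxE; ring. Qed.

Lemma quadratic_minus_line (K : fieldType) N (Q : 'rV[K]_N -> K) a :
  quadratic_form Q -> quadratic_form (minus_line Q a).
Proof.
move=> qQ; split=> [l x|l x y z].
  by rewrite /minus_line linearZ /= quadraticZ // linearZ mxE /=; ring.
by rewrite !polar_minus_line linearD linearZ /= polar_linearl // linearD linearZ /= !mxE; ring.
Qed.

Lemma nondegenerate_minus_line (K : fieldType) N (Q : 'rV[K]_N -> K) a :
    2%:R != 0 :> K -> a != 0 -> quadratic_form Q -> nondegenerate_quadratic Q ->
  nondegenerate_quadratic (minus_line Q a).
Proof.
move=> K2 a0 qQ ndQ x xP.
rewrite -(hsubmxK x); have -> : lsubmx x = 0.
  apply: ndQ => y; have := xP (row_mx y 0).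
  by rewrite polar_minus_line row_mxKl row_mxKr [(0 : 'rV_1) _ _]mxE !mulr0 subr0.
have -> : rsubmx x = 0; last by rewrite row_mx0.
apply/rowP => i; rewrite ord1 [in RHS]mxE.
have := xP (row_mx 0 (const_mx 1));
  rewrite polar_minus_line row_mxKl row_mxKr polar0r // [const_mx _ _ _]mxE.
move/eqP; rewrite mulr1 sub0r oppr_eq0 !mulf_eq0 (negbTE a0) (negbTE K2) /=.
by move/eqP.
Qed.

(** For z = 0 one counts the zeros of Q; for each z != 0 one counts the vectors of
    value a z^2, and these are as many as the vectors of value a. *)
Lemma zeros_minus_line (K : finFieldType) N (Q : 'rV[K]_N -> K) a :
    quadratic_form Q ->
  fiber_card (minus_line Q a) 0 = (fiber_card Q 0%R + #|K|.-1 * fiber_card Q a)%N.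
Proof.
move=> qQ.
pose h (w : K * 'rV[K]_N) : 'rV[K]_(N + 1) := row_mx w.2 (const_mx w.1).
rewrite [LHS]fiber_cardE (reindex h) /=; last first.
  exists (fun x => (rsubmx x 0 0, lsubmx x)).
    by move=> [z y] _; rewrite /h row_mxKl row_mxKr !mxE.
  move=> x _; rewrite /h -[RHS]hsubmxK; congr row_mx; apply/rowP => j.
  by rewrite mxE ord1.
rewrite (eq_bigr (fun p => (Q p.2 == a * p.1 ^+ 2) : nat)); last first.
  by move=> [z y] _; rewrite /minus_line /h row_mxKl row_mxKr mxE subr_eq0.
rewrite -(pair_bigA _ (fun z y => (Q y == a * z ^+ 2) : nat)) /=.
rewrite (eq_bigr (fun z => fiber_card Q (a * z ^+ 2))) => [|z _]; last by rewrite fiber_cardE.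
rewrite (bigD1 0) //= expr0n mulr0; congr (_ + _)%N.
rewrite (eq_bigr (fun=> fiber_card Q a)) => [|z z0].
  by rewrite sum_nat_const (cardC1 (0 : K)).
by rewrite mulrC fiber_scale.
Qed.

(** In odd characteristic the zeros of Q - a z^2, a form in an odd number of
    variables, are independent of a, and they count the vectors of value a. *)
Lemma fiber_uniform (K : finFieldType) N (Q : 'rV[K]_N -> K) a b :
    quadratic_form Q -> nondegenerate_quadratic Q -> ~~ odd N -> a != 0 -> b != 0 ->
  fiber_card Q a = fiber_card Q b.
Proof.
move=> qQ ndQ evenN a0 b0.
have [oddK|evenK] := boolP (odd #|K|); last first.
  have [l lE] := even_char_sqrt (a / b) evenK.
  rewrite -(@fiber_scale K N Q l b) // ?lE ?divfK //.
  have : l ^+ 2 != 0 by rewrite lE mulf_neq0 // invr_neq0.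
  by rewrite expf_eq0.
have K2 : 2%:R != 0 :> K by rewrite -finField_odd.
have Z c : c != 0 ->
    #|K|%:Z * (fiber_card Q 0%R + #|K|.-1 * fiber_card Q c)%N%:Z = #|K|%:Z ^+ (N + 1).
  move=> c0; rewrite -zeros_minus_line //; apply/parabolic_zeros/odd_dim_type.
  - exact: quadratic_minus_line.
  - exact: nondegenerate_minus_line.
  - by rewrite addn1.
have := etrans (Z a a0) (esym (Z b b0)).
have k1 := finNzRing_gt1 K.
have k0 : #|K|%:Z != 0 by lia.
have k2 : (0 < #|K|.-1)%N by case: #|K| k1 => [|[]].
by move/(mulfI k0) => []/addnI/eqP; rewrite eqn_pmul2l // => /eqP.
Qed.

(** * Zeros of the composite with an additive functional *)

Lemma card_additive_image (A : finZmodType) (B : finZmodType) (D : {set A}) (h : A -> B) :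
    (forall x y, x \in D -> y \in D -> x + y \in D) ->
    (forall x y, x \in D -> y \in D -> x - y \in D) ->
    (forall x y, h (x + y) = h x + h y) ->
  #|D| = (#|h @: D| * #|[set x in D | h x == 0%R]|)%N.
Proof.
move=> DD DB hD.
rewrite -[LHS]sum1_card (partition_big h (mem (h @: D))) /=; last by move=> x; apply: imset_f.
rewrite -sum_nat_const; apply: eq_bigr => _ /imsetP[y yD ->].
rewrite sum1_card -[RHS](card_imset _ (addIr y)); apply: eq_card => x.
apply/andP/imsetP => [[xD /eqP xy]|[z]].
  exists (x - y); rewrite ?subrK // inE DB //=.
  by rewrite -(inj_eq (addIr (h y))) -hD subrK xy add0r.
by rewrite inE => /andP[zD /eqP z0] ->; rewrite DD // hD z0 add0r.
Qed.

Lemma card_sum_fibers (X : finType) (R : finType) (U : X -> R) (E : {set R}) :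
  #|[set x | U x \in E]| = (\sum_(e in E) fiber_card U e)%N.
Proof.
rewrite -sum1_card (partition_big U (mem E)) /=; last by move=> x; rewrite inE.
apply: eq_bigr => e eE; rewrite /fiber_card -sum1_card; apply: eq_bigl => x.
by rewrite !inE; case: eqP => [->|]; rewrite ?eE ?andbF.
Qed.

(** With E' the kernel of l on E, the composite has Z = A + B (|E'| - 1) zeros,
    where A is the number of zeros of U and B the common size of the other
    fibers.  Since |E| = |F| |E'|, the formula for A gives |E| B = P^2 - eps P, and
    the formula for Z follows by linear elimination. *)
Lemma zeros_transfer (K F : finFieldType) (X : finType) (U : X -> K) (E : {set K})
    (l : K -> F) (P eps : int) :
    (forall x y, x \in E -> y \in E -> x + y \in E) ->
    (forall x y, x \in E -> y \in E -> x - y \in E) ->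
    (forall x y, l (x + y) = l x + l y) ->
    (forall c, exists2 e, e \in E & l e = c) ->
    (forall x, U x \in E) ->
    (forall e e', e \in E -> e' \in E -> e != 0 -> e' != 0 -> fiber_card U e = fiber_card U e') ->
    #|X|%:Z = P ^+ 2 ->
    #|E|%:Z * (fiber_card U 0)%:Z = P ^+ 2 + eps * (#|E|%:Z - 1) * P ->
  #|F|%:Z * (fiber_card (l \o U) 0)%:Z = P ^+ 2 + eps * (#|F|%:Z - 1) * P.
Proof.
move=> ED EB lD lE UE unif cX cZ.
have l0 : l 0 = 0 by apply: (addIr (l 0)); rewrite -lD !add0r.
have [e1 e1E le1] := lE 1.
have e10 : e1 != 0 by apply: contra_eqN le1 => /eqP->; rewrite l0 eq_sym oner_eq0.
have E0 : 0 \in E by rewrite -(subrr e1) EB.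
pose E' := [set e in E | l e == 0]; have E'0 : 0 \in E' by rewrite inE E0 l0 eqxx.
have cE : #|E| = (#|F| * #|E'|)%N.
  rewrite (card_additive_image ED EB lD); congr (_ * _)%N.
  apply: eq_card => c; rewrite [RHS]inE; have [e eE <-] := lE c; exact: imset_f.
have split_sum (D : {set K}) : D \subset E -> 0 \in D ->
    #|[set x | U x \in D]| = (fiber_card U 0%R + #|D|.-1 * fiber_card U e1)%N.
  move=> /subsetP DE D0; rewrite card_sum_fibers (bigD1 0) //=; congr (_ + _)%N.
  rewrite (cardsD1 0 D) D0 -sum_nat_const /=.
  rewrite (eq_bigl (mem (D :\ 0))) => [|e]; last by rewrite !inE andbC.
  by apply: eq_bigr => e; rewrite !inE => /andP[e0 eD]; apply: unif => //; apply: DE.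
have cU : #|X| = (fiber_card U 0%R + #|E|.-1 * fiber_card U e1)%N.
  rewrite -split_sum // -cardsT; apply: eq_card => x; by rewrite !inE UE.
have cl : fiber_card (l \o U) 0 = (fiber_card U 0%R + #|E'|.-1 * fiber_card U e1)%N.
  rewrite -split_sum //; last by apply/subsetP => e; rewrite inE => /andP[].
  by apply: eq_card => x; rewrite !inE UE.
have q1 := finNzRing_gt1 F.
have R0 : (0 < #|E'|)%N by apply/card_gt0P; exists 0.
rewrite cU PoszD PoszM in cX; rewrite cl PoszD PoszM.
rewrite cE in cX cZ.
move: #|F| #|E'| (fiber_card U 0) (fiber_card U e1) q1 R0 cX cZ {cE cU cl unif split_sum}.
move=> q R A B q1 R0 cX cZ.
rewrite predn_int ?muln_gt0 ?R0 ?(ltnW q1) // in cX; rewrite predn_int //.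
rewrite PoszM in cX cZ.
have qR : q%:Z * R%:Z - 1 != 0 by nia.
have QB : q%:Z * R%:Z * B%:Z = P ^+ 2 - eps * P.
  apply: (mulfI qR).
  transitivity (q%:Z * R%:Z * (A%:Z + (q%:Z * R%:Z - 1) * B%:Z) - q%:Z * R%:Z * A%:Z).
    by ring.
  by rewrite cX cZ; ring.
have R0' : R%:Z != 0 by lia.
apply: (mulfI R0').
transitivity (q%:Z * R%:Z * A%:Z + (R%:Z - 1) * (q%:Z * R%:Z * B%:Z)); first by ring.
by rewrite QB cZ; ring.
Qed.

(** * Squares and the relative trace in a quadratic extension *)

Lemma card_roots (K : finFieldType) (p : {poly K}) :
  p != 0 -> (#|[set x | p.[x] == 0%R]| < size p)%N.
Proof.
move=> p0; rewrite cardE; apply: max_poly_roots p0 _ (enum_uniq _).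
by apply/allP => x; rewrite mem_enum inE.
Qed.

Section Euler.
Variable K : finFieldType.
Hypothesis oddK : odd #|K|.
Local Notation h := (#|K|.-1./2).

Lemma card_half : #|K| = h.*2.+1.
Proof.
have := odd_double_half #|K|; rewrite oddK add1n => <-.
by rewrite /= doubleK.
Qed.

Lemma expf_card1 (a : K) : a != 0 -> a ^+ h.*2 = 1.
Proof.
move=> a0; apply: (mulfI a0); rewrite -exprS -card_half expf_card mulr1.
by [].
Qed.

(** Nonzero squares are roots of X^h - 1, where h = (k - 1) / 2, and there are at
    least h of them by [card_sqr_image]. *)
Lemma euler_criterion (a : K) : a != 0 -> is_square a <-> a ^+ h = 1.
Proof.
pose S := [set x ^+ 2 | x : K] :\ 0; pose R := [set x : K | ('X^h - 1).[x] == 0].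
have h0 : (0 < h)%N by have := finNzRing_gt1 K; rewrite {1}card_half; case: (h).
have SR : S \subset R.
  apply/subsetP => y /setD1P[y0 /imsetP[x _ yE]]; rewrite yE inE.
  rewrite !hornerE -exprM mul2n expf_card1 ?subrr //.
  by move: y0; rewrite yE expf_eq0.
have /eqP SE : S == R.
  rewrite eqEcard SR /=.
  have p0 : 'X^h - 1 != 0 :> {poly K} by rewrite -size_poly_gt0 size_XnsubC.
  have := card_roots p0; rewrite -/R size_XnsubC // ltnS => /leq_trans; apply.
  have := card_sqr_image K; rewrite (cardsD1 0) -/S.
  have -> : 0 \in [set x ^+ 2 | x : K] by apply/imsetP; exists 0; rewrite ?expr0n.
  by rewrite {1}card_half /= add1n; move: h #|S| => n s; lia.
move=> a0; split=> [[b ab]|aR].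
  have : a \in R by rewrite -SE !inE a0; apply/imsetP; exists b.
  by rewrite inE !hornerE subr_eq0 => /eqP.
have : a \in S by rewrite SE inE !hornerE aR subrr.
by case/setD1P=> _ /imsetP[b _ ->]; exists b.
Qed.

Lemma euler_sign (a : K) : a != 0 -> a ^+ h = 1 \/ a ^+ h = -1.
Proof.
move=> a0; have := expf_card1 a0; rewrite -muln2 exprM => /eqP.
by rewrite sqrf_eq1 => /orP[]/eqP; [left|right].
Qed.

(** Euler's criterion makes the square class multiplicative; in particular the
    product of two nonsquares is a square. *)
Lemma is_squareM (a b : K) : a != 0 -> b != 0 ->
  is_square (a * b) <-> (is_square a <-> is_square b).
Proof.
move=> a0 b0; rewrite !euler_criterion ?mulf_neq0 // exprMn.
have N1 : -1 = 1 :> K -> False.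
  by apply/eqP; rewrite eq_sym -subr_eq0 opprK -(finField_odd K).
by case: (euler_sign a0) => ->; case: (euler_sign b0) => ->;
   rewrite ?mulr1 ?mul1r ?mulrNN ?mulr1; tauto.
Qed.

Lemma fiber_square (c a : K) : c != 0 -> a != 0 ->
  (is_square (a / c) -> fiber_card (fun x : 'rV[K]_1 => c * x 0 0 ^+ 2) a = 2%N) /\
  (~ is_square (a / c) -> fiber_card (fun x : 'rV[K]_1 => c * x 0 0 ^+ 2) a = 0%N).
Proof.
move=> c0 a0; split=> [[l lE]|nsq].
  have l0 : l != 0.
    have : l ^+ 2 != 0 by rewrite -lE mulf_neq0 // invr_neq0.
    by rewrite expf_eq0.
  have -> : fiber_card (fun x : 'rV[K]_1 => c * x 0 0 ^+ 2) a =
      #|[set (const_mx l : 'rV[K]_1); const_mx (- l)]|.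
    apply: eq_card => x; rewrite !inE.
    have -> : (c * x 0 0 ^+ 2 == a) = (x 0 0 ^+ 2 == l ^+ 2).
      by rewrite -lE -[RHS](inj_eq (mulfI c0)) [c * (a / c)]mulrC divfK.
    have xc d : (x == const_mx d) = (x 0 0 == d).
      by apply/eqP/eqP => [->|<-]; [rewrite mxE|apply/rowP => i; rewrite mxE ord1].
    by rewrite eqf_sqr !xc.
  rewrite cards2; case: eqP => // /rowP/(_ 0)/eqP; rewrite !mxE -subr_eq0 opprK.
  rewrite -mulr2n -mulr_natl mulf_eq0 (negbTE l0) orbF.
  by have := oddK; rewrite finField_odd => /negbTE ->.
rewrite fiber_cardE big1 // => x _; apply/eqP; rewrite eqb0; apply/negP => /eqP xE.
by apply: nsq; exists (x 0 0); rewrite -xE mulrC mulKf.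
Qed.

End Euler.

(** Here K has q^2 elements, q is odd, and the maps involved concern the subfield of
    order q, given as the set of fixed points of the Frobenius map x |-> x^q. *)
Section Frobenius.
Variables (K : finFieldType) (q : nat).
Hypotheses (oddK : odd #|K|) (Kq : #|K| = (q ^ 2)%N) (pcharq : [pchar K].-nat q).

Definition subfield : {set K} := [set x | x ^+ q == x].
Definition rel_trace (x : K) := x + x ^+ q.

Lemma frobD (x y : K) : (x + y) ^+ q = x ^+ q + y ^+ q.
Proof. exact: exprDn_pchar. Qed.

Lemma odd_frob : odd q.
Proof. by move: oddK; rewrite Kq oddX. Qed.

Lemma frobN (x : K) : (- x) ^+ q = - x ^+ q.
Proof. by rewrite exprNn -signr_odd odd_frob mulN1r. Qed.

Lemma frobK (x : K) : (x ^+ q) ^+ q = x.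
Proof. by rewrite -exprM mulnn -Kq expf_card. Qed.

Lemma q_gt1 : (1 < q)%N.
Proof. by have := finNzRing_gt1 K; rewrite Kq; case: q => [|[]]. Qed.

Lemma subfieldD x y : x \in subfield -> y \in subfield -> x + y \in subfield.
Proof. by rewrite !inE frobD => /eqP-> /eqP->. Qed.

Lemma subfieldB x y : x \in subfield -> y \in subfield -> x - y \in subfield.
Proof. by rewrite !inE frobD frobN => /eqP-> /eqP->. Qed.

Lemma rel_trace_subfield x : rel_trace x \in subfield.
Proof. by rewrite inE /rel_trace frobD frobK addrC. Qed.

(** Both sets consist of roots of a polynomial of degree q, so they have at most
    q elements; as the first contains the image of [rel_trace] and the second is
    its kernel, the product of their sizes is at least q^2. *)
Lemma card_subfield : #|subfield| = q /\ #|[set x : K | rel_trace x == 0]| = q.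
Proof.
have q1 := q_gt1.
have cE : (#|subfield| <= q)%N.
  have p0 : size ('X^q - 'X : {poly K}) = q.+1.
    by rewrite size_polyDl ?size_polyN ?size_polyXn ?size_polyX.
  have := @card_roots K ('X^q - 'X); rewrite -size_poly_gt0 p0 ltnS => /(_ isT).
  suff -> : subfield = [set x | ('X^q - 'X).[x] == 0] by [].
  by apply/setP => x; rewrite !inE !hornerE subr_eq0.
have cT : (#|[set x : K | rel_trace x == 0%R]| <= q)%N.
  have p0 : size ('X^q + 'X : {poly K}) = q.+1.
    by rewrite size_polyDl ?size_polyXn ?size_polyX.
  have := @card_roots K ('X^q + 'X); rewrite -size_poly_gt0 p0 ltnS => /(_ isT).
  suff -> : [set x : K | rel_trace x == 0] = [set x | ('X^q + 'X).[x] == 0] by [].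
  by apply/setP => x; rewrite !inE !hornerE addrC.
have im_le : (#|rel_trace @: [set: K]| <= #|subfield|)%N.
  by apply/subset_leq_card/subsetP => _ /imsetP[x _ ->]; apply: rel_trace_subfield.
have := @card_additive_image K K [set: K] rel_trace.
rewrite cardsT Kq => /(_ (fun _ _ _ _ => in_setT _) (fun _ _ _ _ => in_setT _)).
have hD x y : rel_trace (x + y) = rel_trace x + rel_trace y.
  by rewrite /rel_trace frobD; ring.
move=> /(_ hD).
have -> : [set x in [set: K] | rel_trace x == 0] = [set x | rel_trace x == 0].
  by apply/setP => x; rewrite !inE.
by move: im_le cE cT; rewrite -mulnn; move: (#|_|) (#|_|) (#|_|) => a b c; nia.
Qed.

Lemma half_card : #|K|.-1./2 = (q.-1 * q.+1./2)%N.
Proof.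
have [n qE] : exists n, q = n.*2.+1.
  by exists q./2; rewrite -[LHS]odd_double_half odd_frob.
rewrite Kq qE -doubleS doubleK [n.*2.+1.-1]/=.
rewrite (_ : (_ ^ 2).-1 = (n.*2 * n.+1).*2)%N ?doubleK //.
by rewrite -mulnn; lia.
Qed.

(** e^((q^2 - 1) / 2) is a power of e^(q - 1) = 1, because q + 1 is even. *)
Lemma subfield_square e : e \in subfield -> e != 0 -> is_square e.
Proof.
rewrite inE => /eqP eq e0; apply/euler_criterion => //.
rewrite half_card exprM (_ : e ^+ q.-1 = 1) ?expr1n //.
by apply: (mulfI e0); rewrite -exprS prednK ?(ltnW q_gt1) // eq mulr1.
Qed.

(** Here b^(q - 1) = -1, so Euler's criterion reads (-1)^((q + 1) / 2) = 1. *)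
Lemma rel_trace0_square b : rel_trace b = 0 -> b != 0 ->
  is_square b <-> (q = 3 %[mod 4])%N.
Proof.
move=> b0 bn0; rewrite euler_criterion // half_card exprM.
have -> : b ^+ q.-1 = -1.
  apply: (mulfI bn0); rewrite -exprS prednK ?(ltnW q_gt1) // mulrN1.
  by apply/eqP; rewrite -subr_eq0 opprK addrC; apply/eqP.
have N1 : (-1 : K) != 1.
  by rewrite eq_sym -subr_eq0 opprK -(finField_odd K).
rewrite -signr_odd; have := odd_frob.
case: (boolP (odd q.+1./2)) => oddh oddq; rewrite ?expr1 ?expr0; split=> //.
- by move/eqP; rewrite (negbTE N1).
- by move=> q3; exfalso; move: oddh oddq q3; lia.
- by move=> _; move: oddh oddq; lia.
Qed.

Section Parabolic.
Variables (N m : nat) (Q : 'rV[K]_N -> K) (c alpha : K) (eps : int).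
Hypotheses (NE : N = m.*2.+1) (qQ : quadratic_form Q) (c0 : c != 0) (alpha0 : alpha != 0).
Hypothesis Qc : isometric Q (witt_sum (fun x : 'rV_1 => c * x 0 0 ^+ 2) m).
Local Notation U := (fun x => rel_trace (alpha * Q x)).

(** The quotient of two nonzero elements of the subfield is a square l^2 in K, and
    scaling vectors by l multiplies [rel_trace (alpha * Q x)] by l^2. *)
Lemma rel_trace_uniform e e' : e \in subfield -> e' \in subfield -> e != 0 -> e' != 0 ->
  fiber_card U e = fiber_card U e'.
Proof.
move=> eE e'E e0 e'0.
have [||l lE] := @subfield_square (e / e').
- by move: eE e'E; rewrite !inE exprMn exprVn => /eqP-> /eqP->.
- by rewrite mulf_neq0 // invr_neq0.
have l0 : l != 0.
  have : l ^+ 2 != 0 by rewrite -lE mulf_neq0 // invr_neq0.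
  by rewrite expf_eq0.
rewrite !fiber_cardE (reindex (fun x => l *: x)) /=; last first.
  by exists (fun x => l^-1 *: x) => x _; rewrite scalerA ?mulVf ?mulfV ?scale1r.
apply: eq_bigr => x _; rewrite quadraticZ //.
have l2E : (l ^+ 2) ^+ q = l ^+ 2.
  by rewrite -lE exprMn exprVn; move: eE e'E; rewrite !inE => /eqP-> /eqP->.
have -> : rel_trace (alpha * (l ^+ 2 * Q x)) = l ^+ 2 * rel_trace (alpha * Q x).
  by rewrite /rel_trace mulrCA exprMn l2E mulrDr.
by rewrite -[e](divfK e'0) lE (inj_eq (mulfI _)) ?expf_neq0.
Qed.

(** The zeros are sorted by the value b = alpha Q(x), which runs over the kernel of
    [rel_trace].  For b = 0 there are k^(2m) vectors, and k^(2m) + eps k^m for each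
    of the q - 1 other b, where k = q^2. *)
Lemma rel_trace_zeros :
    (forall b, rel_trace b = 0 -> b != 0 ->
       (is_square (b / alpha / c) /\ eps = 1) \/ (~ is_square (b / alpha / c) /\ eps = -1)) ->
  q%:Z * (fiber_card U 0)%:Z = (q%:Z ^+ N) ^+ 2 + eps * (q%:Z - 1) * q%:Z ^+ N.
Proof.
move=> epsP; set k := #|K|%:Z.
have k0 : k != 0 by have := finNzRing_gt1 K; rewrite /k; lia.
have kq : k = q%:Z ^+ 2 by rewrite /k Kq -mulnn PoszM expr2.
have [_ cker] := card_subfield.
pose D := [set x : K | rel_trace x == 0].
have D0 : 0 \in D by rewrite inE /rel_trace expr0n gtn_eqF ?(ltnW q_gt1) // addr0.
have -> : fiber_card U 0 = (\sum_(b in D) fiber_card Q (b / alpha))%N.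
  transitivity (\sum_(b in D) fiber_card (fun x => (alpha * Q x)%R) b)%N.
    by rewrite -card_sum_fibers; apply: eq_card => x; rewrite !inE.
  apply: eq_bigr => b _; rewrite !fiber_cardE; apply: eq_bigr => x _.
  by rewrite -[in RHS](inj_eq (mulfI alpha0)) mulrCA mulfV // mulr1 .
have kfib b : b \in D -> b != 0 ->
    k * (fiber_card Q (b / alpha))%:Z = k ^+ N + eps * k ^+ m.+1.
  rewrite inE => /eqP bT b0; rewrite (fiber_isometric _ Qc) fiber_witt_sum // -/k.
  have ba0 : b / alpha != 0 by rewrite mulf_neq0 // invr_neq0.
  have [F1 F2] := fiber_square oddK c0 ba0; rewrite [k ^+ m.+1]exprS.
  by case: (epsP b bT b0) => -[/[swap] ->]; [move/F1|move/F2] => ->; ring.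
have kfib0 : k * (fiber_card Q (0 / alpha))%:Z = k ^+ N.
  rewrite mul0r (fiber_isometric _ Qc) fiber_witt_sum // -/k.
  by rewrite fiber_line0 //; ring.
apply: (mulfI k0); rewrite mulrCA.
have -> : k * (\sum_(b in D) fiber_card Q (b / alpha))%N%:Z =
    q%:Z * k ^+ N + (q%:Z - 1) * eps * k ^+ m.+1.
  rewrite (bigD1 0) //= PoszD mulrDr kfib0 -[(\sum_(_ | _) _)%N%:Z]natz natr_sum mulr_sumr.
  rewrite (eq_bigr (fun=> k ^+ N + eps * k ^+ m.+1)) => [|b /andP[bD b0]]; last first.
    by rewrite natz kfib.
  rewrite sumr_const.
  have -> : #|[pred i in D | i != 0]| = q.-1.
    rewrite -cker (cardsD1 0 [set x | _]) -/D D0 /=; apply: eq_card => b.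
    by rewrite !inE andbC.
  rewrite -mulr_natr natz predn_int; last exact: ltnW q_gt1.
  by ring.
rewrite NE kq -!exprM.
have -> : q%:Z ^+ (2 * m.*2.+1) = (q%:Z ^+ m.*2.+1) ^+ 2 by rewrite mulnC exprM.
have -> : q%:Z ^+ (2 * m.+1) = q%:Z * q%:Z ^+ m.*2.+1.
  by rewrite -exprS mul2n doubleS.
rewrite exprM; ring.
Qed.

End Parabolic.
End Frobenius.

(** * The form attached to a decomposition into hyperbolic lines *)

Lemma quadratic_sum (K : fieldType) N (Q : 'rV[K]_N -> K) (I : finType) (F : I -> 'rV[K]_N) :
    quadratic_form Q -> (forall i j, i != j -> polar_form Q (F i) (F j) = 0) ->
  Q (\sum_i F i) = \sum_i Q (F i).
Proof.
move=> qQ orthF; have := index_enum_uniq I; elim: (index_enum I) => [|i s IHs] /=.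
  by rewrite !big_nil quadratic0.
case/andP=> is_ us; rewrite !big_cons quadraticD IHs //.
suff -> : polar_form Q (F i) (\sum_(j <- s) F j) = 0 by rewrite addr0.
rewrite polar_sumr // big_seq big1 // => j js.
by apply: orthF; apply: contraNneq is_ => ->.
Qed.

(** The vectors x0 and the hyperbolic pairs form a basis: pairing a linear
    combination with them recovers its coordinates, as 2 is invertible. *)
Lemma parabolic_decomposition_isometric (K : fieldType) N n (Q : 'rV[K]_N -> K)
    (l : 'I_n -> {vspace 'rV[K]_N}) x0 :
    2%:R != 0 :> K -> quadratic_form Q -> N = n.*2.+1 ->
    parabolic_decomposition Q l x0 ->
  isometric Q (witt_sum (fun x : 'rV_1 => Q x0 * x 0 0 ^+ 2) n).
Proof.
move=> K2 qQ NE [hyp_l Qx0 orth_l orth_x0 _].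
have /fin_all_exists[e eP] (i : 'I_n) : exists e : 'rV[K]_N * 'rV[K]_N,
    [/\ e.1 \in l i, e.2 \in l i, Q e.1 = 0, Q e.2 = 0 & polar_form Q e.1 e.2 = 1].
  by have [_ [x [y xy]]] := hyp_l i; exists (x, y).
pose p (x : 'rV[K]_N) (i : 'I_n) :=
  Xc x (1 + i.*2) *: (e i).1 + Xc x (1 + i.*2).+1 *: (e i).2.
pose g (x : 'rV[K]_N) : 'rV[K]_N := Xc x 0 *: x0 + \sum_i p x i.
have XcP a x y k : Xc (a *: x + y : 'rV[K]_N) k = a * Xc x k + Xc y k.
  have [kN|Nk] := ltnP k N.
    by rewrite -[k]/(val (Ordinal kN)) !Xc_ord !mxE.
  by rewrite /Xc insubF /= ?mulr0 ?addr0 // ltnNge Nk.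
have [A gA] : exists A : 'M[K]_N, forall x, g x = x *m A.
  apply: rV_linear_mx => a x y; rewrite /g XcP scalerDr scalerA.
  rewrite scaler_sumr scalerDl addrACA -big_split /=; congr (_ + _).
  apply: eq_bigr => i _; rewrite /p !XcP scalerDr !scalerA !scalerDl.
  by rewrite addrACA.
have p_l x i : p x i \in l i.
  by have [e1 e2 _ _ _] := eP i; rewrite memvD // memvZ.
have orth_p x i j u : i != j -> u \in l j -> polar_form Q (p x i) u = 0.
  by move=> ij uj; apply: (orth_l i j ij).
have orth_x x i : polar_form Q (p x i) x0 = 0.
  by apply: (orth_x0 i) => //; rewrite memv_line.
have polar_x0 x : polar_form Q (g x) x0 = 2%:R * Q x0 * Xc x 0.
  rewrite polarDl // polarZl // polarxx // [X in _ + X]polarC polar_sumr // big1.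
    by rewrite addr0 mulrC.
  by move=> i _; rewrite polarC.
have polar_l x i u : u \in l i -> polar_form Q (g x) u = polar_form Q (p x i) u.
  move=> ui; rewrite polarDl // polarZl // [polar_form Q x0 u]polarC.
  rewrite (orth_x0 i) ?memv_line // mulr0 add0r polarC polar_sumr // (bigD1 i) //=.
  rewrite big1 ?addr0; first by rewrite polarC.
  by move=> j ji; rewrite polarC (orth_p x j i).
have Qe i : polar_form Q (e i).1 (e i).1 = 0 /\ polar_form Q (e i).2 (e i).2 = 0.
  by have [_ _ Q1 Q2 _] := eP i; rewrite !polarxx // Q1 Q2 !mulr0.
exists A => [|x].
  apply: unitmx_rV_inj => x; rewrite -gA => gx0.
  suff Xx k : (k < N)%N -> Xc x k = 0.
    by apply/rowP => i; rewrite mxE -Xc_ord Xx.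
  case: k => [|k kN].
    move=> _; apply/eqP; have /eqP := polar_x0 x; rewrite gx0 polar0l // eq_sym.
    by rewrite !mulf_eq0 (negbTE K2) (negbTE Qx0).
  have kn : (k./2 < n)%N by move: kN; rewrite NE; lia.
  pose i := Ordinal kn.
  have [e1 e2 _ _ e12] := eP i; have [e11 e22] := Qe i.
  have := polar_l x i _ e1; have := polar_l x i _ e2; rewrite gx0 !polar0l // /p.
  rewrite !polarDl // !polarZl // e11 e22 e12 [polar_form Q (e i).2 _]polarC e12.
  rewrite !mulr0 !mulr1 addr0 add0r -[k]odd_double_half => /esym X1 /esym X2.
  by case: (odd k).
rewrite -gA /g quadraticD (quadraticZ qQ) polar_sumr // [X in _ + X]big1 => [|i _]; last first.
  by rewrite polarZl // polarC orth_x mulr0.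
rewrite addr0 quadratic_sum // => [|i j ij]; last exact: (orth_p x i j).
rewrite /witt_sum mxE mulrC; congr (_ + _); apply: eq_bigr => i _.
have [_ _ Q1 Q2 e12] := eP i.
by rewrite quadraticD polarZl // polarZr // !quadraticZ // Q1 Q2 e12; ring.
Qed.

(** In characteristic 2 the coordinate X_0 enters the parabolic normal form only
    through the additive function X_0^2, so the first basis vector is in the
    radical. *)
Lemma parabolic_char (K : fieldType) N (Q : 'rV[K]_N -> K) :
    quadratic_form Q -> nondegenerate_quadratic Q -> parabolic_type Q ->
  2%:R != 0 :> K.
Proof.
move=> qQ ndQ [m [NE [c [A [c0 uA QA]]]]]; apply/eqP => K2.
subst N.
pose e : 'rV[K]_m.*2.+1 := delta_mx 0 0.
have e0 : e != 0 by apply/eqP => /rowP/(_ 0)/eqP; rewrite !mxE eqxx oner_eq0.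
suff eA0 : e *m A = 0.
  by case/eqP: e0; rewrite -(mulmxK uA e) eA0 mul0mx.
apply: ndQ => z; rewrite -(mulmxKV uA z); move: (z *m _) => y.
rewrite /polar_form -mulmxDl !QA.
have X0 x : Xc (e + x) 0 = 1 + Xc x 0.
  by rewrite -[0%N]/(val (0 : 'I_m.*2.+1)) !Xc_ord !mxE.
have XS x k : Xc (e + x) k.+1 = Xc x k.+1.
  have [kN|Nk] := ltnP k.+1 m.*2.+1.
    by rewrite -[k.+1]/(val (Ordinal kN)) !Xc_ord !mxE /= add0r.
  by rewrite /Xc insubF // ltnNge Nk.
have e_0 : Xc e 0 = 1.
  by rewrite -[0%N]/(val (0 : 'I_m.*2.+1)) Xc_ord mxE.
have e_S k : Xc e k.+1 = 0.
  have := XS 0 k; rewrite addr0 => ->; rewrite /Xc; case: insubP => //= u _ _; by rewrite mxE.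
rewrite /parabolic_normal_form X0 e_0.
under eq_bigr do rewrite !XS.
under [X in _ - c * (_ + X) - _]eq_bigr do rewrite !e_S mulr0.
rewrite big1_eq.
transitivity (2%:R * (c * Xc y 0)); first by ring.
by rewrite K2 mul0r.
Qed.

(** * The trace map of a field extension *)

Section Trace.
Variables (F : finFieldType) (L : fieldExtType F).

Lemma pchar_natX i : [pchar L].-nat (#|F| ^ i)%N.
Proof.
have [p p_pr Fp] := finPcharP F.
have chL : p \in [pchar L] by rewrite pchar_lalg.
by rewrite pnatX (card_pprimeChar Fp) pnatX (pnatE _ p_pr) chL.
Qed.

Lemma alg_inj : injective (fun a : F => a%:A : L).
Proof. exact: (fmorph_inj (in_alg L)). Qed.

Lemma expf_card_iter (a : F) i : a ^+ (#|F| ^ i) = a.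
Proof. by elim: i => [|i IHi]; rewrite ?expr1 // expnS exprM expf_card. Qed.

Lemma trace_linear (a : F) (x y : L) : trace (a%:A * x + y) = a * trace x + trace y.
Proof.
apply: alg_inj; rewrite /= traceE scalerDl -scalerA !traceE /trace_sum.
rewrite scaler_sumr -big_split /=; apply: eq_bigr => i _.
rewrite exprDn_pchar ?pchar_natX // exprMn; congr (_ + _).
rewrite -[(a%:A) ^+ _](rmorphXn (in_alg L)) /=.
by rewrite expf_card_iter mulr_algl.
Qed.

Lemma trace_frob (x : L) i : trace (x ^+ (#|F| ^ i)) = trace x.
Proof.
elim: i x => [|i IHi] x; first by rewrite expr1.
rewrite expnS exprM IHi; apply: alg_inj; rewrite /= !traceE /trace_sum.
have : x ^+ (#|F| ^ \dim {:L}) = x.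
  by apply/eqP; rewrite -Fermat's_little_theorem memvf.
case: (\dim {:L}) (adim_gt0 {:L}%AS) => // d _ xq.
rewrite big_ord_recr big_ord_recl /= -exprM -expnS xq expn0 expr1 addrC; congr (_ + _).
by apply: eq_bigr => j _; rewrite -exprM -expnS.
Qed.

End Trace.

(** * Descent along the trace *)

Lemma is_square_dec (K : finFieldType) (a : K) : is_square a \/ ~ is_square a.
Proof.
case: (pickP (fun b => a == b ^+ 2)) => [b /eqP ab|nsq]; first by left; exists b.
by right=> -[b ab]; have := nsq b; rewrite ab eqxx.
Qed.

(** The two possible types have different numbers of zeros, so the number of zeros
    determines the type. *)
Lemma zeros_even_type (K : finFieldType) N m (Q : 'rV[K]_N -> K) (eps : int) :
    N = m.*2 -> quadratic_form Q -> nondegenerate_quadratic Q ->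
    #|K|%:Z * (fiber_card Q 0)%:Z =
      (#|K|%:Z ^+ m) ^+ 2 + eps * (#|K|%:Z - 1) * #|K|%:Z ^+ m ->
  (eps = 1 -> hyperbolic_type Q) /\ (eps = -1 -> elliptic_type Q).
Proof.
move=> NE qQ ndQ; have k1 := finNzRing_gt1 K.
pose d := (#|K|%:Z - 1) * #|K|%:Z ^+ m.
have d0 : 0 < d.
  by rewrite /d; move: #|K| k1 => k k1; rewrite Num.Theory.mulr_gt0 ?Num.Theory.exprn_gt0 //; lia.
have kN : (#|K|%:Z ^+ m) ^+ 2 = #|K|%:Z ^+ N by rewrite -exprM NE muln2.
have Hh : hyperbolic_type Q -> _ = _ + d := hyperbolic_zeros NE.
have He : elliptic_type Q -> _ = _ - d := elliptic_zeros NE.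
rewrite kN -mulrA -/d; clearbody d.
have [|hQ|eQ] := even_dim_type qQ ndQ; first by rewrite NE odd_double.
- by rewrite (Hh hQ) => H; split=> // eps1; move: H; rewrite eps1; lia.
- by rewrite (He eQ) => H; split=> // eps1; move: H; rewrite eps1; lia.
Qed.

(** The extension is given here by two finite fields and an embedding iota, and the
    trace only through two properties: it is F-linear and invariant under
    Frobenius. *)
Section Descent.
Variables (F K : finFieldType) (t r : nat) (iota : {rmorphism F -> K}) (tr : K -> F).
Local Notation q := #|F|.
Hypotheses (cardK : #|K| = (q ^ t)%N) (t_gt0 : (0 < t)%N) (r_gt0 : (0 < r)%N).
Hypothesis trP : forall a x y, tr (iota a * x + y) = a * tr x + tr y.
Hypothesis tr_frob : forall x i, tr (x ^+ (q ^ i)) = tr x.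
Variable phi : 'rV[F]_(r * t) -> 'rV[K]_r.
Hypothesis phi_bij : bijective phi.
Hypothesis phiP : forall a u v, phi (a *: u + v) = iota a *: phi u + phi v.
Variables (Q : 'rV[K]_r -> K) (alpha : K).
Hypotheses (qQ : quadratic_form Q) (ndQ : nondegenerate_quadratic Q) (alpha0 : alpha != 0).
Let R v := tr (alpha * Q (phi v)).
Hypothesis ndR : nondegenerate_quadratic R.

Lemma trD x y : tr (x + y) = tr x + tr y.
Proof. by rewrite -[x]mul1r -(rmorph1 iota) trP mul1r rmorph1 mul1r. Qed.

Lemma tr0 : tr 0 = 0.
Proof. by apply: (addIr (tr 0)); rewrite -trD !add0r. Qed.

Lemma trZ a x : tr (iota a * x) = a * tr x.
Proof. by rewrite -[_ * x]addr0 trP tr0 addr0. Qed.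

Lemma trN x : tr (- x) = - tr x.
Proof. by rewrite -mulN1r -(rmorph1 iota) -rmorphN trZ mulN1r. Qed.

Lemma phi0 : phi 0 = 0.
Proof.
have := phiP 1 0 0; rewrite rmorph1 !scale1r addr0 => H.
by apply: (addIr (phi 0)); rewrite -H add0r.
Qed.

Lemma phiZ a u : phi (a *: u) = iota a *: phi u.
Proof. by rewrite -[a *: u]addr0 phiP phi0 addr0. Qed.

Lemma phiD u v : phi (u + v) = phi u + phi v.
Proof. by rewrite -[u]scale1r phiP rmorph1 !scale1r. Qed.

Lemma quadratic_descent : quadratic_form R.
Proof.
have E u v : polar_form R u v = tr (alpha * polar_form Q (phi u) (phi v)).
  by rewrite /polar_form /R -!trN -!trD phiD; congr tr; ring.
split=> [a u|a u v w].
  by rewrite /R phiZ quadraticZ // mulrCA -rmorphXn trZ.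
by rewrite !E phiP polar_linearl // mulrDr mulrCA trP.
Qed.

Lemma descent_neq0 : exists v, R v != 0.
Proof.
case: (pickP (fun v => R v != 0)) => [v Rv|R0]; first by exists v.
have {}R0 v : R v = 0 by apply/eqP/negbFE/R0.
have [x x0] : exists x : 'rV[F]_(r * t), x != 0.
  have : (0 < r * t)%N by rewrite muln_gt0 r_gt0.
  case: (r * t)%N => // n _; exists (const_mx 1); apply/eqP => /rowP/(_ 0)/eqP.
  by rewrite !mxE oner_eq0.
by case/eqP: x0; apply: ndR => y; rewrite /polar_form !R0 !subr0.
Qed.

Lemma zeros_descent : fiber_card R 0 = fiber_card (fun x => tr (alpha * Q x)) 0.
Proof.
rewrite !fiber_cardE [RHS](reindex phi) //; exact: onW_bij.
Qed.

Lemma card_source : #|'rV[K]_r|%:Z = (q%:Z ^+ (r * t)).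
Proof.
by rewrite card_mx mul1n cardK -expnM Posz_expn mulnC.
Qed.

Lemma even_descent m (eps : int) : r = m.*2 ->
    #|K|%:Z * (fiber_card Q 0)%:Z = #|K|%:Z ^+ r + eps * (#|K|%:Z - 1) * #|K|%:Z ^+ m ->
  (eps = 1 -> hyperbolic_type R) /\ (eps = -1 -> elliptic_type R).
Proof.
move=> rE cQ; apply: (@zeros_even_type F _ (m * t)%N) quadratic_descent ndR _.
  by rewrite rE doubleMl.
have KE : #|K|%:Z ^+ m = q%:Z ^+ (m * t).
  by rewrite cardK Posz_expn -exprM mulnC.
rewrite zeros_descent -KE.
apply: (@zeros_transfer K F _ Q [set: K] (fun x => tr (alpha * x))).
- by move=> x y; rewrite !inE.
- by move=> x y; rewrite !inE.
- by move=> x y; rewrite mulrDr trD.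
- move=> c; have [v Rv] := descent_neq0.
  exists (iota (c / R v) * Q (phi v)); rewrite // mulrCA trZ; exact: divfK.
- by move=> x; rewrite inE.
- by move=> a b _ _ a0 b0; apply: fiber_uniform => //; rewrite rE odd_double.
- by rewrite -exprM muln2 -rE card_mx mul1n Posz_expn.
- by rewrite cardsT -exprM muln2 -rE.
Qed.

Lemma hyperbolic_descent : hyperbolic_type Q -> hyperbolic_type R.
Proof.
move=> hQ; have [m [rE _]] := hQ.
have [|H _] := @even_descent m 1 rE; last exact: H.
by rewrite (hyperbolic_zeros rE hQ) mul1r.
Qed.

Lemma elliptic_descent : elliptic_type Q -> elliptic_type R.
Proof.
move=> eQ; have [m [f [rE _ _ _]]] := eQ; rewrite -doubleS in rE.
have [|_ H] := @even_descent m.+1 (-1) rE; last exact: H.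
by rewrite (elliptic_zeros rE eQ) mulN1r mulNr.
Qed.

Section ParabolicEven.
Variables (m : nat) (c : K) (eps : int).
Hypotheses (oddK : odd #|K|) (even_t : ~~ odd t) (rE : r = m.*2.+1) (c0 : c != 0).
Hypothesis pchar_q : forall i, [pchar K].-nat (q ^ i)%N.
Hypothesis Qc : isometric Q (witt_sum (fun x : 'rV_1 => c * x 0 0 ^+ 2) m).
Let e := (q ^ t./2)%N.
Hypothesis epsP :
  ((e = 3 %[mod 4])%N <-> is_square (alpha * c)) /\ eps = 1 \/
  ~ ((e = 3 %[mod 4])%N <-> is_square (alpha * c)) /\ eps = -1.

Lemma parabolic_descent :
  (eps = 1 -> hyperbolic_type R) /\ (eps = -1 -> elliptic_type R).
Proof.
have tE : t = t./2.*2 by rewrite -[LHS]odd_double_half (negbTE even_t).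
have Ke : #|K| = (e ^ 2)%N by rewrite cardK {1}tE -expnM muln2.
have K2 : 2%:R != 0 :> K by rewrite -finField_odd.
have pe := pchar_q t./2 : [pchar K].-nat e.
have rtE : (r * t = (r * t./2).*2)%N by rewrite {1}tE -doubleMr.
apply: (zeros_even_type rtE quadratic_descent ndR).
pose U x := rel_trace e (alpha * Q x).
(* The trace is Frobenius-invariant, so tr y = tr ((y + y^e) / 2). *)
have trU x : tr (alpha * Q x) = tr (2%:R^-1 * U x).
  rewrite /U /rel_trace mulrDr trD.
  have -> : 2%:R^-1 * (alpha * Q x) ^+ e = (2%:R^-1 * (alpha * Q x)) ^+ e.
    rewrite [RHS]exprMn; congr (_ * _); rewrite exprVn; congr (_^-1).
    by rewrite -[2%:R]/(1 + 1 : K) frobD // !expr1n.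
  by rewrite tr_frob -trD; congr tr; field.
rewrite zeros_descent.
rewrite (@eq_fiber_card _ _ _ ((fun y => tr (2%:R^-1 * y)) \o U) 0 trU).
have [cardE cardker] := card_subfield oddK Ke pe.
have PE : e%:Z ^+ r = q%:Z ^+ (r * t./2).
  by rewrite Posz_expn -exprM mulnC.
rewrite -PE; apply: (zeros_transfer (E := subfield K e)).
- exact: subfieldD.
- exact: subfieldB.
- by move=> x y; rewrite mulrDr trD.
- move=> d; have [v Rv] := descent_neq0.
  exists (iota (d / R v) * U (phi v)).
    have := rel_trace_subfield Ke pe (alpha * Q (phi v)); rewrite -/(U _) !inE exprMn => /eqP ->.
    by rewrite -rmorphXn expf_card_iter.
  by rewrite mulrCA trZ -trU divfK.
- by move=> x; apply: rel_trace_subfield.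
- exact: rel_trace_uniform.
- rewrite card_source PE -exprM; congr (_ ^+ _); lia.
- rewrite cardE; apply: (rel_trace_zeros oddK Ke pe rE c0 alpha0 Qc) => b bT b0.
  have ba0 : b / alpha / c != 0 by rewrite !mulf_neq0 // invr_neq0.
  have sqb : is_square b <-> (is_square (b / alpha / c) <-> is_square (alpha * c)).
    rewrite -is_squareM ?mulf_neq0 ?invr_neq0 //.
    by rewrite (_ : b / alpha / c * (alpha * c) = b) //; field; apply/andP.
  have := rel_trace0_square oddK Ke pe bT b0.
  have := is_square_dec (b / alpha / c); have := is_square_dec (alpha * c).
  by case: epsP => -[]; tauto.
Qed.

End ParabolicEven.
End Descent.

Theorem theorem3p3 (q r t : nat) (F : finFieldType) (L : fieldExtType F)
    (hq : #|F| = q) (ht : \dim {:L} = t) (hr : (0 < r)%N) (ht0 : (0 < t)%N)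
    (phi : 'rV[F]_(r * t) -> 'rV[L]_r) (hphi : identification phi)
    (Q : 'rV[L]_r -> L) (hQ : quadratic_form Q) (hQnd : nondegenerate_quadratic Q)
    (alpha : L) (halpha : alpha != 0)
    (hLQnd : nondegenerate_quadratic (LQ phi alpha Q)) :
  [/\ hyperbolic_type Q -> hyperbolic_type (LQ phi alpha Q),
      elliptic_type Q -> elliptic_type (LQ phi alpha Q) &
      parabolic_type Q ->
        odd q /\
        forall (s : int) (gamma : L),
          has_sign Q s -> gamma != 0 ->
          (s = 1 -> is_square gamma) -> (s = -1 -> ~ is_square gamma) ->
          let hyperbolic_case :=
            ((q ^ t./2 = 1 %[mod 4])%N /\ ~ is_square (alpha * gamma)) \/
            ((q ^ t./2 = 3 %[mod 4])%N /\ is_square (alpha * gamma)) in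
          [/\ odd t -> parabolic_type (LQ phi alpha Q),
              ~~ odd t -> hyperbolic_case -> hyperbolic_type (LQ phi alpha Q) &
              ~~ odd t -> ~ hyperbolic_case -> elliptic_type (LQ phi alpha Q)]].
Proof.
(* The same field L, with its structure of finite type. *)
pose K : finFieldType := finvect_type L.
pose iota : {rmorphism F -> K} := in_alg L.
pose tr : K -> F := @trace F L.
have cardK : #|K| = (#|F| ^ t)%N.
  by rewrite -ht -(card_vspace {:finvect_type L}) card_vspacef.
have trP a x y : tr (iota a * x + y) = a * tr x + tr y by apply: trace_linear.
have tr_frob x i : tr (x ^+ (#|F| ^ i)) = tr x by apply: trace_frob.
have [phi_bij phi_lin] := hphi.
have phiP a u v : (phi (a *: u + v) : 'rV[K]_r) = iota a *: (phi u : 'rV[K]_r) + phi v.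
  exact: phi_lin.
have qR := quadratic_descent trP phiP alpha hQ : quadratic_form (LQ phi alpha Q).
split.
- exact: (hyperbolic_descent cardK ht0 hr trP phi_bij phiP hQ hQnd hLQnd).
- exact: (elliptic_descent cardK ht0 hr trP phi_bij phiP hQ hQnd hLQnd).
move=> parQ; have K2 : 2%:R != 0 :> K := parabolic_char hQ hQnd parQ.
have oddK : odd #|K| by rewrite finField_odd.
have oddq : odd q by move: oddK; rewrite cardK oddX eqn0Ngt ht0 hq.
split=> // s gamma [n [l [x0 [rE dec sgn]]]] gamma0 gsq gnsq /=.
have c0 : Q x0 != 0 by have [_ ? _ _ _] := dec.
have Qc := parabolic_decomposition_isometric (K := K) K2 hQ rE dec.
have gammaE : is_square (alpha * gamma) <-> is_square (alpha * Q x0).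
  have H1 := is_squareM (K := K) oddK halpha gamma0.
  have H2 := is_squareM (K := K) oddK halpha c0.
  by case: sgn => -[sq sE]; [move: (gsq sE)|move: (gnsq sE)] => sq'; move: H1 H2; tauto.
have odde : odd (q ^ t./2) by rewrite oddX oddq orbT.
have e13 : (q ^ t./2 = 1 %[mod 4] \/ q ^ t./2 = 3 %[mod 4])%N.
  by move: (q ^ t./2)%N odde => e; lia.
have e1n3 : (q ^ t./2 = 1 %[mod 4] -> q ^ t./2 = 3 %[mod 4] -> False)%N.
  by move: (q ^ t./2)%N => e; lia.
have := is_square_dec (K := K) (alpha * Q x0).
rewrite -hq in e13 e1n3 * => sq_dec.
have descent (eps : int) event := parabolic_descent (eps := eps) cardK ht0 hr trP tr_frob
  phi_bij phiP hQ halpha hLQnd oddK event rE c0 (@pchar_natX F L) Qc.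
split=> [oddt|event hyp|event hyp].
- by apply: odd_dim_type qR hLQnd _; rewrite oddM oddt andbT rE /= odd_double.
- apply: (proj1 (descent 1 event _)) => //; left; split=> //.
  by move: hyp gammaE e13 e1n3 sq_dec; tauto.
- apply: (proj2 (descent (-1) event _)) => //; right; split=> //.
  by move: hyp gammaE e13 e1n3 sq_dec; tauto.
Qed.
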